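(* Fix $\alpha\in(1,2)$ so that $r=\frac\alpha{\alpha-1}$ is an integer. Let $t\in\mathbb R$, $t\ne0$, be such that $c_{t,r}:=t^{1-r}(r-1)^{r-1}r^{-r}$ is Khinchin–Lévy. Then $$\sup_x\Big|\sum_{N\le n<2N}e(tn^\alpha+xn)\Big|\lesssim_{\alpha,t}N^{\frac\alpha2+}\,N^{-(\alpha-1)2^{1-r}},\qquad N\in\mathbb N.$$ In particular, the bound holds for a.e. $t$.
   Context: $e(\theta)=e^{2\pi i\theta}$; the supremum is over $x\in\mathbb R$ (equivalently over $\mathbb R/\mathbb Z$). $A\lesssim_{\alpha,t}N^{s+}$ means: for every $\epsilon>0$ there is a constant $C=C(\epsilon,\alpha,t)$ with $A\le CN^{s+\epsilon}$ for all $N$. $\beta\in\mathbb R\setminus\mathbb Q$ is called Khinchin–Lévy if there is a strictly increasing sequence $\{q_n\}_{n\in\mathbb N}$ of natural numbers such that for every $\epsilon>0$, $q_{n+1}\le q_n^{1+\epsilon}$ for all $n>N_\epsilon$, and for each $n$ there is an integer $a_n$ coprime to $q_n$ with $|\beta-\frac{a_n}{q_n}|\le\frac1{q_n^2}$. *)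

(* Defs.v *)
From HB Require Import structures.
From mathcomp Require Import all_boot all_order all_algebra.
From mathcomp Require Import all_classical all_reals all_analysis.
From mathcomp Require Import complex.
Set Implicit Arguments.
Unset Strict Implicit.
Unset Printing Implicit Defensive.
Import Order.TTheory GRing.Theory Num.Theory.
Local Open Scope classical_set_scope.
Local Open Scope ring_scope.

(* e(theta) = exp(2 pi i theta) *)
Definition e (R : realType) (theta : R) : R[i] :=
  Complex (cos (2 * pi * theta)) (sin (2 * pi * theta)).

Definition weyl_sum (R : realType) (t alpha x : R) (N : nat) : R[i] :=
  \sum_(N <= n < 2 * N) e (t * n%:R `^ alpha + x * n%:R).

(* The supremum is taken in the extended reals, where it always exists:
   [sup] on [R] would silently return 0 on an unbounded set. *)
Definition sup_weyl_sum (R : realType) (t alpha : R) (N : nat) : \bar R :=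
  ereal_sup (range (fun x : R =>
    (ComplexField.Normc.normc (weyl_sum t alpha x N))%:E)).

(* A <~ N^{s+}; whatever A and s depend on, C may depend on as well. *)
Definition lesssim_plus (R : realType) (A : nat -> \bar R) (s : R) : Prop :=
  forall eps : R, 0 < eps ->
  exists C : R, forall N : nat, (A N <= (C * N%:R `^ (s + eps))%:E)%E.

(* Positivity of [q n] excludes the junk value 1 / 0 = 0. *)
Definition khinchin_levy (R : realType) (beta : R) : Prop :=
  @irrational R beta /\
  exists q : nat -> nat,
    [/\ {homo q : m n / (m < n)%N},
        forall n, (0 < q n)%N,
        forall eps : R, 0 < eps -> exists Neps : nat, forall n : nat,
          (Neps < n)%N -> (q n.+1)%:R <= (q n)%:R `^ (1 + eps)
      & forall n, exists2 a : int, coprimez a (q n) &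
          `|beta - a%:~R / (q n)%:R| <= 1 / (q n)%:R ^+ 2].

Definition c_coef (R : realType) (t : R) (r : int) : R :=
  t ^ (1 - r) * (r%:~R - 1) ^ (r - 1) * r%:~R ^ (- r).

Definition weyl_bound (R : realType) (alpha : R) (r : int) (t : R) : Prop :=
  lesssim_plus (sup_weyl_sum t alpha)
    (alpha / 2 - (alpha - 1) * 2 ^ (1 - r)).

(* Main.v *)
(** The B-process without Poisson summation.  With [r = alpha / (alpha - 1)] and
    [c = c_coef t r], the phase [v n - c v ^ r] in [v] is stationary at a point
    [v_n] of size [n ^ (alpha - 1)], where its value is exactly [t n ^ alpha].
    So stationary phase writes [e (t n ^ alpha)], up to an amplitude monotone in
    [n] and an error [O(1 / n)], as the integral of [e (v n - c v ^ r)] over an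
    interval that does not depend on [n].  Multiplying by [e (x n)] and summing
    over [n] under the integral produces a Dirichlet kernel in [x + v], of [L1]
    norm [O(log N)], times a Weyl sum of degree [r] with leading coefficient [- c]
    over [O(N ^ (alpha - 1))] consecutive points.  Weyl's inequality bounds the
    latter uniformly as soon as [c] has denominators of good rational
    approximations at every scale, which the Khinchin-Levy property provides and
    which, by Borel-Cantelli and Dirichlet's theorem, holds for almost every [t].
    Integrals only occur as increments of antiderivatives, so that estimating
    them amounts to the mean value inequality. *)
Require Import Defs.
From HB Require Import structures.
From mathcomp Require Import all_boot all_order all_algebra.
From mathcomp Require Import all_classical all_reals all_analysis.
From mathcomp Require Import complex ring lra zify.
Import Order.TTheory GRing.Theory Num.Theory.
Import numFieldNormedType.Exports.
Local Open Scope classical_set_scope.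
Local Open Scope ring_scope.
Set Implicit Arguments.
Unset Strict Implicit.
Unset Printing Implicit Defensive.
(** * The divisor bound *)

Section DivisorBound.
Local Open Scope nat_scope.

(** Put d = r - 1, so that alpha - 1 = 1/d and 2^(1-r) = 2^-d. The dual sum has length about
    N^(1/d), and Weyl's inequality saves 2^-d in the exponent of that length, while undoing the
    stationary phase amplitude costs N^(1-alpha/2); since 1 - alpha/2 + 1/d = alpha/2, this gives
    the stated exponent. The errors O(1/n), multiplied by the inverse amplitude and summed over N
    terms, contribute only O(N^(1-alpha/2)). At the end one divides by the constant of stationary
    phase: its value is immaterial, but it must not vanish, hence the lower bound for a Fresnel sine
    integral. The interval of integration does depend on x: it starts at the fractional part of -x
    and has integer length. Uniformity in x thus rests on Weyl's inequality being uniform under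
    translation of the points. *)

Lemma size_divisors (n : nat) :
  size (divisors n) = \prod_(f <- prime_decomp n) f.2.+1.
Proof.
rewrite /divisors; elim: (prime_decomp n) => [|[p k] s IHs] /=.
  by rewrite big_nil.
rewrite big_cons /= -IHs; elim: k => [|k IHk] /=; first by rewrite mul1n.
by rewrite size_merge size_cat size_map IHk mulSn addnC.
Qed.

(** Since k + 1 <= 2^k, a base p >= 2^K absorbs (k + 1)^K into p^k. For smaller p, k + 1 <= K (k/K +
    1) <= K 2^(k/K) with integer division, and the K-th power of this is at most K^K 2^k. *)
Lemma exp_succn_le (K k p : nat) : 0 < K -> 1 < p ->
  k.+1 ^ K <= (if p < 2 ^ K then K ^ K else 1) * p ^ k.
Proof.
move=> K0 p1; case: ltnP => [_|pK].
  have h : k.+1 <= K * 2 ^ (k %/ K).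
    apply: leq_trans (ltn_ceil k K0) _; rewrite mulnC leq_mul2l.
    by apply/orP; right; exact: ltn_expl.
  apply: (@leq_trans ((K * 2 ^ (k %/ K)) ^ K)); first by rewrite leq_exp2r.
  rewrite expnMn leq_mul2l; apply/orP; right.
  rewrite -expnM; apply: (@leq_trans (2 ^ k)).
    by rewrite leq_exp2l // leq_divM.
  by case: k {h} => [|k] //; rewrite leq_exp2r.
rewrite mul1n; apply: (@leq_trans ((2 ^ k) ^ K)).
  by rewrite leq_exp2r // ltn_expl.
rewrite -expnM mulnC expnM.
by case: k => [|k] //; rewrite leq_exp2r.
Qed.

Lemma prod_succn_le (K : nat) (s : seq (nat * nat)) : 0 < K ->
  all (fun f => 1 < f.1) s ->
  (\prod_(f <- s) f.2.+1) ^ K <=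
  (K ^ K) ^ count (fun p => p < 2 ^ K) (map fst s) * \prod_(f <- s) f.1 ^ f.2.
Proof.
move=> K0; elim: s => [|[p k] s IHs] /=; first by rewrite !big_nil exp1n.
move=> /andP[p1 /IHs {}IHs]; rewrite !big_cons /= expnMn.
apply: leq_trans (leq_mul (exp_succn_le k K0 p1) IHs) _.
rewrite expnD; case: ifP => _; rewrite ?expn1 ?expn0 ?mul1n.
  by rewrite mulnACA.
by rewrite mulnCA.
Qed.

(* Only the primes below [2 ^ K] can contribute a factor exceeding 1 to
   [size (divisors n) ^ K / n]. *)
Lemma size_divisors_expn_le (K n : nat) : 0 < K -> 0 < n ->
  size (divisors n) ^ K <= (K ^ K) ^ (2 ^ K) * n.
Proof.
move=> K0 n0; rewrite size_divisors.
have pd1 : all (fun f => 1 < f.1) (prime_decomp n).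
  apply/allP => -[p k] /mem_prime_decomp[pp _ _] /=.
  exact: prime_gt1.
apply: leq_trans (prod_succn_le K0 pd1) _.
rewrite -prod_prime_decomp // leq_mul2r; apply/orP; right.
apply: leq_pexp2l; first by rewrite expn_gt0 K0.
rewrite -size_filter -[X in _ <= X](size_iota 0).
apply: uniq_leq_size; first by rewrite filter_uniq // primes_uniq.
by move=> p; rewrite mem_filter mem_iota add0n => /andP[].
Qed.

Lemma count_dvdn_le (L k : nat) : 0 < k ->
  count (fun h => h %| k) (index_iota 1 L) <= size (divisors k).
Proof.
move=> k0; rewrite -size_filter; apply: uniq_leq_size.
  by rewrite filter_uniq // iota_uniq.
by move=> h; rewrite mem_filter -dvdn_divisors // => /andP[].
Qed.

End DivisorBound.

Section SumsOverProducts.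
Variable R : realType.
Implicit Types (g : nat -> R).

Lemma sum_multiples_le g (h Z : nat) : (0 < h)%N -> (forall k, 0 <= g k) ->
  \sum_(1 <= m < Z.+1) g (h * m)%N <=
  \sum_(1 <= k < (h * Z).+1 | (h %| k)%N) g k.
Proof.
move=> h0 g0; elim: Z => [|Z IHZ].
  by rewrite big_geq // sumr_ge0.
have hZ : (h * Z <= h * Z.+1)%N by rewrite leq_mul2l leqnSn orbT.
rewrite [leLHS]big_nat_recr //= [leRHS](@big_cat_nat _ _ _ (h * Z).+1) //=.
apply: lerD; first exact: IHZ.
rewrite big_mkcond big_nat_recr /=; last by rewrite ltn_pmul2l.
rewrite dvdn_mulr // lerDr sumr_ge0 // => k _.
by case: ifP.
Qed.

(** Group the products h m by their value k: exchanging the sums leaves, for each k, the number of h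
    dividing k. *)
Lemma sum_products_le g (L Z : nat) (D : R) : (forall k, 0 <= g k) ->
  (forall k, (0 < k <= L * Z)%N -> (size (divisors k))%:R <= D) ->
  \sum_(1 <= h < L) \sum_(1 <= m < Z.+1) g (h * m)%N <=
  D * \sum_(1 <= k < (L * Z).+1) g k.
Proof.
move=> g0 dD.
apply: (@le_trans _ _
  (\sum_(1 <= h < L) \sum_(1 <= k < (L * Z).+1 | (h %| k)%N) g k)).
  rewrite big_nat [leRHS]big_nat; apply: ler_sum => h /andP[h0 hL].
  apply: le_trans (sum_multiples_le Z h0 g0) _.
  have hZ : (h * Z <= L * Z)%N by rewrite leq_mul2r (ltnW hL) orbT.
  rewrite [leRHS](@big_cat_nat _ _ _ (h * Z).+1) //=.
  by rewrite lerDl sumr_ge0.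
under eq_bigr do rewrite big_mkcond /=.
rewrite exchange_big /= mulr_sumr big_nat [leRHS]big_nat.
apply: ler_sum => k /andP[k0 kLZ].
rewrite -big_mkcond /= big_const_seq iter_addr_0 -[X in X <= _]mulr_natl.
apply: ler_wpM2r => //; apply: le_trans (dD k _); last by rewrite k0.
by rewrite ler_nat; exact: count_dvdn_le.
Qed.

End SumsOverProducts.
(** * Mean value inequalities and the complex exponential *)

Section MeanValue.
Variable R : realType.
Implicit Types (f g : R -> R) (a b : R).

Lemma derive_continuous f (l x : R) : is_derive x 1 f l -> {for x, continuous f}.
Proof. by move=> [fx _]; exact/differentiable_continuous/derivable1_diffP. Qed.

Lemma derive_ge0_le f f' a b : a <= b ->
  (forall x, a <= x <= b -> is_derive x 1 f (f' x)) ->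
  (forall x, a <= x <= b -> 0 <= f' x) -> f a <= f b.
Proof.
move=> ab df f'0; rewrite -subr_ge0.
have [x xab|x|c] := @MVT_segment R f f' a b ab.
- by apply: df; move: xab; rewrite in_itv /= => /andP[/ltW -> /ltW ->].
- move: x; apply: continuous_in_subspaceT => x; rewrite inE /= in_itv /= => xab.
  exact/derive_continuous/df.
- rewrite in_itv /= => cab ->; rewrite mulr_ge0 ?subr_ge0 //; exact: f'0.
Qed.

Lemma derive_le f g f' g' a b : a <= b ->
  (forall x, a <= x <= b -> is_derive x 1 f (f' x)) ->
  (forall x, a <= x <= b -> is_derive x 1 g (g' x)) ->
  (forall x, a <= x <= b -> f' x <= g' x) -> f b - f a <= g b - g a.
Proof.
move=> ab df dg fg.
suff : (g - f) a <= (g - f) b by rewrite !fctE; lra.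
apply: (@derive_ge0_le _ (fun x => g' x - f' x)) => // x xab.
  by have := df x xab; have := dg x xab => ? ?; exact: is_deriveB.
by rewrite subr_ge0 fg.
Qed.

Lemma derive_norm_le f g f' g' a b : a <= b ->
  (forall x, a <= x <= b -> is_derive x 1 f (f' x)) ->
  (forall x, a <= x <= b -> is_derive x 1 g (g' x)) ->
  (forall x, a <= x <= b -> `|f' x| <= g' x) -> `|f b - f a| <= g b - g a.
Proof.
move=> ab df dg fg; rewrite ler_norml; apply/andP; split.
  have := @derive_le (- g) f (fun x => - g' x) f' a b ab.
  rewrite !fctE; move=> /(_ _ df) H.
  have : - g b - - g a <= f b - f a.
    apply: H => x xab; first by have := dg x xab => ?; exact: is_deriveN.
    by have := fg x xab; rewrite ler_norml => /andP[].
  lra.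
apply: (derive_le ab df dg) => x /fg.
by rewrite ler_norml => /andP[].
Qed.

Lemma derive_norm_le_cst f f' a b C : a <= b ->
  (forall x, a <= x <= b -> is_derive x 1 f (f' x)) ->
  (forall x, a <= x <= b -> `|f' x| <= C) -> `|f b - f a| <= C * (b - a).
Proof.
move=> ab df fC; rewrite mulrBr.
apply: (derive_norm_le (g := fun x => C * x) ab df) fC => x _.
by apply: is_derive_eq; rewrite /GRing.scale /= mulr1.
Qed.

End MeanValue.

Section ComplexExponential.
Variable R : realType.
Implicit Types (x y : R) (z w : R[i]).

Local Notation normc := ComplexField.Normc.normc.

Lemma normcD z w : normc (z + w) <= normc z + normc w.
Proof. by rewrite -lecR rmorphD; exact: (ler_normD z w). Qed.

Lemma normc_ge0 z : 0 <= normc z.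
Proof. by case: z => a b; exact: sqrtr_ge0. Qed.

Lemma normcN z : normc (- z) = normc z.
Proof. by case: z => a b /=; rewrite !sqrrN. Qed.

Lemma normc_sqr z : normc z ^+ 2 = complex.Re z ^+ 2 + complex.Im z ^+ 2.
Proof. by case: z => a b /=; rewrite sqr_sqrtr // addr_ge0 ?sqr_ge0. Qed.

Lemma Re_le_normc z : complex.Re z <= normc z.
Proof.
case: z => a b /=; apply: le_trans (ler_norm a) _; rewrite -sqrtr_sqr ler_wsqrtr //.
by rewrite lerDl sqr_ge0.
Qed.

Lemma normc_real x : normc x%:C%C = `|x|.
Proof. by rewrite /= expr0n addr0 sqrtr_sqr. Qed.

Lemma normc_sum (I : Type) (s : seq I) (P : pred I) (F : I -> R[i]) :
  normc (\sum_(i <- s | P i) F i) <= \sum_(i <- s | P i) normc (F i).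
Proof.
elim/big_ind2: _ => [|a b c d ab cd|//].
  by rewrite ComplexField.Normc.normc0.
by apply: le_trans (normcD _ _) _; exact: lerD.
Qed.

Lemma eD x y : e (x + y) = e x * e y.
Proof.
by rewrite /e mulrDr cosD sinD /GRing.mul /= [X in _ = Complex _ X]addrC.
Qed.

Lemma e0 : e 0 = 1 :> R[i].
Proof. by rewrite /e mulr0 cos0 sin0. Qed.

Lemma normc_e x : normc (e x) = 1.
Proof. by rewrite /= cos2Dsin2 sqrtr1. Qed.

Lemma eN x : e (- x) = (e x)^*%C.
Proof. by rewrite /e mulrN cosN sinN. Qed.

Lemma e_nat (n : nat) : e n%:R = 1 :> R[i].
Proof.
elim: n => [|n IHn]; first exact: e0.
by rewrite -natr1 eD IHn mul1r /e mulr1 mulr_natl cos2pi sin2pi.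
Qed.

Lemma e_int (m : int) : e m%:~R = 1 :> R[i].
Proof.
case: m => n; first exact: e_nat.
by rewrite NegzE mulrNz eN e_nat /= oppr0.
Qed.

Lemma normc_1Be x : normc (1 - e x) = 2 * `|sin (pi * x)|.
Proof.
have -> : 2 * `|sin (pi * x)| = Num.sqrt ((2 * sin (pi * x)) ^+ 2).
  by rewrite sqrtr_sqr normrM ger0_norm.
congr Num.sqrt; rewrite -mulrA mulr_natl cos_mulr2n sin_mulr2n.
by have := cos2Dsin2 (pi * x); nra.
Qed.

(** With y = pi x / 2, monotonicity of sin - y cos gives y cos y <= sin y, so sin (2 y) = 2 sin y
    cos y >= 2 y cos^2 y. As cos (2 y) >= 0, cos^2 y >= 1/2, and pi >= 2 finishes. *)
Lemma sinpi_ge x : 0 <= x <= 1 / 2 -> x <= sin (pi * x).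
Proof.
move=> /andP[x0 x1]; have pi2 := pi_ge2 R.
pose f (y : R) := sin y - y * cos y.
have df y : is_derive y 1 f (y * sin y).
  rewrite /f; apply: is_derive_eq.
  rewrite /GRing.scale /=; ring.
have f0 (y : R) : 0 <= y <= pi / 2 -> y * cos y <= sin y.
  move=> /andP[y0 y1].
  suff : f 0 <= f y by rewrite /f mul0r subr0 sin0; lra.
  apply: (derive_ge0_le y0 (fun u _ => df u)) => z /andP[z0 zy].
  by rewrite mulr_ge0 // sin_ge0_pi // z0; lra.
have [y0 y1] : 0 <= pi * x <= pi / 2 /\ x <= pi * x / 2.
  by have := pi_gt0 R; nra.
have c0 : 0 <= cos (pi * x) by apply: cos_ge0_pihalf; move: y0; lra.
have h : pi * x / 2 * cos (pi * x / 2) <= sin (pi * x / 2).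
  by apply: f0; move: y0; lra.
have c1 : 0 <= cos (pi * x / 2) by apply: cos_ge0_pihalf; move: y0; lra.
have E : pi * x = (pi * x / 2) *+ 2 by rewrite -mulr_natl; field.
move: c0; rewrite E sin_mulr2n cos_mulr2n => c0.
rewrite -mulr_natl; move: h c1 c0 y1 x0; set c := cos _; set s := sin _; nra.
Qed.

Lemma sinpi_int x (m : int) : `|sin (pi * (x + m%:~R))| = `|sin (pi * x)|.
Proof.
have := normc_1Be (x + m%:~R); rewrite eD e_int mulr1 normc_1Be.
by move=> H; apply: (@mulfI _ 2) => //; rewrite -H.
Qed.

Lemma sinpi_sym x : sin (pi * (1 - x)) = sin (pi * x).
Proof. by rewrite mulrBr mulr1 sinB sinpi cospi mul0r sub0r mulN1r opprK. Qed.

Lemma sinpi_inv_le x : 0 < x < 1 -> `|sin (pi * x)|^-1 <= x^-1 + (1 - x)^-1.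
Proof.
move=> /andP[x0 x1].
have x'0 : 0 < x^-1 by rewrite invr_gt0.
have x'1 : 0 < (1 - x)^-1 by rewrite invr_gt0 subr_gt0.
have [h|h] := leP x (1 / 2).
  have s0 : x <= sin (pi * x) by apply: sinpi_ge; lra.
  rewrite ger0_norm; last lra.
  by apply: (@le_trans _ _ x^-1); [rewrite lef_pV2 ?posrE; lra|lra].
have s0 : 1 - x <= sin (pi * (1 - x)) by apply: sinpi_ge; lra.
rewrite -sinpi_sym ger0_norm; last lra.
by apply: (@le_trans _ _ (1 - x)^-1); [rewrite lef_pV2 ?posrE; lra|lra].
Qed.

(** Multiplying by 1 - e x telescopes the sum. The product form needs no exception at integer x. *)
Lemma geometric_sum_le (l : nat) x y :
  normc (\sum_(k < l) e (y + k%:R * x)) * `|sin (pi * x)| <= 1.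
Proof.
have E : (1 - e x) * \sum_(k < l) e (y + k%:R * x) = e y - e (y + l%:R * x).
  elim: l => [|l IHl]; first by rewrite big_ord0 mulr0 mul0r addr0 subrr.
  rewrite big_ord_recr mulrDr IHl mulrBl mul1r -eD -natr1 addrA subrK.
  by congr (_ - e _); ring.
have : normc ((1 - e x) * \sum_(k < l) e (y + k%:R * x)) <= 1 + 1.
  by rewrite E; apply: le_trans (normcD _ _) _; rewrite normcN !normc_e.
by rewrite ComplexField.Normc.normcM normc_1Be; lra.
Qed.

Lemma normc_e_sum_le (l : nat) (f : nat -> R) :
  normc (\sum_(k < l) e (f k)) <= l%:R.
Proof.
apply: le_trans (normc_sum _ _ _) _.
under eq_bigr do rewrite normc_e.
by rewrite sumr_const card_ord.
Qed.

End ComplexExponential.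
(** * Weyl's inequality *)

Section WeylDifferencing.
Variable R : realType.
Implicit Types (f : nat -> R) (c : R).

Local Notation normc := ComplexField.Normc.normc.

Definition expsum f (l : nat) : R[i] := \sum_(k < l) e (f k).

(** In the expanded square the pairs (k + h, k) and (k, k + h) are conjugate, whence twice the real
    part; this counts the diagonal h = 0 twice, whence - l. *)
Lemma sqr_normc_expsum f (l : nat) :
  normc (expsum f l) ^+ 2 =
  2 * complex.Re (\sum_(h < l) expsum (fun k => f (k + h)%N - f k) (l - h)) - l%:R.
Proof.
elim: l => [|l IHl].
  by rewrite /expsum !big_ord0 ComplexField.Normc.normc0 expr0n /= mulr0 subr0.
have -> : \sum_(h < l.+1) expsum (fun k => f (k + h)%N - f k) (l.+1 - h) =
    \sum_(h < l) expsum (fun k => f (k + h)%N - f k) (l - h) +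
    (1 + e (f l) * (expsum f l)^*%C).
  (* Each inner sum, the new one at h = l included, gains exactly one last term. *)
  transitivity (\sum_(h < l.+1) (expsum (fun k => f (k + h)%N - f k) (l - h) +
                                 e (f l - f (l - h)%N))).
    apply: eq_bigr => h _.
    have hl : (h <= l)%N by rewrite -ltnS.
    by rewrite subSn // /expsum big_ord_recr /= subnK.
  rewrite big_split /= big_ord_recr /= subnn {2}/expsum big_ord0 addr0.
  congr (_ + _).
  rewrite (reindex_inj rev_ord_inj) /= big_ord_recr /= addrC; congr (_ + _).
    by rewrite subSS subnn subn0 subrr e0.
  rewrite /expsum rmorph_sum mulr_sumr; apply: eq_bigr => k _ /=.
  by rewrite subSS subKn 1?ltnW // eD eN.
rewrite /expsum big_ord_recr -/(expsum f l) /= -natr1.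
move: IHl; rewrite !normc_sqr !raddfD /=.
case: (expsum f l) => a b /=.
have := cos2Dsin2 (2 * pi * f l).
by set s := sin _; set c := cos _; nra.
Qed.

Lemma sqr_normc_expsum_le f (l L : nat) : (l <= L)%N ->
  normc (expsum f l) ^+ 2 <=
  2 * \sum_(h < L) normc (expsum (fun k => f (k + h)%N - f k) (l - h)).
Proof.
move=> lL; rewrite sqr_normc_expsum.
have H := Re_le_normc (\sum_(h < l) expsum (fun k => f (k + h)%N - f k) (l - h)).
have H2 := normc_sum (index_enum 'I_l) xpredT
  (fun h => expsum (fun k => f (k + h)%N - f k) (l - h)).
have H3 : \sum_(h < l) normc (expsum (fun k => f (k + h)%N - f k) (l - h)) <=
   \sum_(h < L) normc (expsum (fun k => f (k + h)%N - f k) (l - h)).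
  pose F h := normc (expsum (fun k => f (k + h)%N - f k) (l - h)).
  rewrite -(big_mkord xpredT F) -[leRHS](big_mkord xpredT F).
  rewrite [leRHS](@big_cat_nat _ _ _ l) //= lerDl sumr_ge0 // => *.
  exact: normc_ge0.
have l0 : 0 <= l%:R :> R by [].
move: H H2 H3 l0; set u := complex.Re _; set v := normc _ => H H2 H3 l0.
have := le_trans H (le_trans H2 H3); lra.
Qed.

Lemma sqr_sum_le (L : nat) (x : 'I_L -> R) :
  (\sum_(h < L) x h) ^+ 2 <= L%:R * \sum_(h < L) x h ^+ 2.
Proof.
elim: L x => [|L IHL] x; first by rewrite !big_ord0 expr0n mulr0.
rewrite !big_ord_recr /= -natr1; set a := x ord_max.
have {IHL} := IHL (fun i => x (widen_ord (leqnSn L) i)).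
have : 2 * a * \sum_(i < L) x (widen_ord (leqnSn L) i) <=
    \sum_(i < L) x (widen_ord (leqnSn L) i) ^+ 2 + L%:R * a ^+ 2.
  have -> : L%:R * a ^+ 2 = \sum_(i < L) a ^+ 2.
    by rewrite sumr_const card_ord mulr_natl.
  rewrite mulr_sumr -big_split /=; apply: ler_sum => i _.
  by have := sqr_ge0 (x (widen_ord (leqnSn L) i) - a); nra.
by set S := \sum_(i < L) _ => *; nra.
Qed.

(** Cauchy-Schwarz iterated d times. The factor L on the left stands for the exponent 2^d - 1 on the
    right and avoids subtraction. *)
Lemma expr_sum_le (L d : nat) (x : 'I_L -> R) : (forall h, 0 <= x h) ->
  L%:R * (\sum_(h < L) x h) ^+ (2 ^ d) <=
  L%:R ^+ (2 ^ d) * \sum_(h < L) x h ^+ (2 ^ d).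
Proof.
elim: d x => [|d IHd] x x0; first by rewrite !expr1.
have E (y : R) : y ^+ (2 ^ d.+1) = (y ^+ 2) ^+ (2 ^ d) by rewrite expnS exprM.
rewrite !E; under [X in _ <= _ * X]eq_bigr do rewrite E.
apply: (@le_trans _ _ (L%:R * (L%:R * \sum_(h < L) x h ^+ 2) ^+ (2 ^ d))).
  rewrite ler_wpM2l // lerXn2r ?nnegrE ?sqr_ge0 ?sqr_sum_le //.
  by rewrite mulr_ge0 ?sumr_ge0 // => h _; exact: sqr_ge0.
rewrite exprMn mulrCA [_ ^+ 2 in leRHS]expr2 exprMn -mulrA.
rewrite ler_wpM2l ?exprn_ge0 //.
by apply: IHd => h; exact: sqr_ge0.
Qed.

(* [f] agrees with a polynomial of degree at most [d.+1] whose coefficient of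
   degree [d.+1] is [c], up to what iterated differencing can detect. *)
Fixpoint weyl_class (d : nat) c f : Prop :=
  match d with
  | 0 => exists b, forall k, f k = b + k%:R * c
  | d'.+1 => forall h : nat,
      weyl_class d' (d.+1%:R * c * h%:R) (fun k => f (k + h)%N - f k)
  end.

(** Unfolded, this is the sum over h_1, ..., h_d < L of b at (d+1)! c h_1 ... h_d, the slope left
    after d differencings. *)
Fixpoint weyl_majorant (b : R -> R) (L d : nat) c : R :=
  match d with
  | 0 => b c
  | d'.+1 => \sum_(h < L) weyl_majorant b L d' (d.+1%:R * c * h%:R)
  end.

(** This is the minimum of L and 1 / |sin (pi c)|, tested without division: at integer c the inverse
    would be 0^-1 = 0. *)
Definition geom_bound (L : nat) c : R :=
  if L%:R * `|sin (pi * c)| <= 1 then L%:R else `|sin (pi * c)|^-1.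

Lemma geom_bound_ge0 L c : 0 <= geom_bound L c.
Proof. by rewrite /geom_bound; case: ifP; rewrite ?invr_ge0. Qed.

Lemma geom_bound_le L c : geom_bound L c <= L%:R.
Proof.
rewrite /geom_bound; case: ifP => // /negbT; rewrite -ltNge => H.
have s0 : 0 < `|sin (pi * c)|.
  by rewrite lt_neqAle normr_ge0 andbT; apply: contraTneq H => <-; rewrite mulr0 ltr10.
by rewrite -[leLHS]mul1r ler_pdivrMr // ltW.
Qed.

Lemma geom_bound_le_inv L c : 0 < `|sin (pi * c)| ->
  geom_bound L c <= `|sin (pi * c)|^-1.
Proof.
move=> s0; rewrite /geom_bound; case: ifP => // H.
by rewrite -[leRHS]mul1r ler_pdivlMr.
Qed.

Lemma geom_boundDint L c (m : int) : geom_bound L (c + m%:~R) = geom_bound L c.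
Proof. by rewrite /geom_bound sinpi_int. Qed.

Lemma expsum_linear_le (b c : R) f (l L : nat) : (l <= L)%N ->
  (forall k, f k = b + k%:R * c) -> normc (expsum f l) <= geom_bound L c.
Proof.
move=> lL fE; rewrite /geom_bound; case: ifP => [_|/negbT].
  by apply: le_trans (normc_e_sum_le _ _) _; rewrite ler_nat.
rewrite -ltNge => H.
have s0 : 0 < `|sin (pi * c)|.
  by rewrite lt_neqAle normr_ge0 andbT; apply: contraTneq H => <-; rewrite mulr0 ltr10.
rewrite -[leRHS]mul1r ler_pdivlMr // /expsum.
under eq_bigr do rewrite fE.
exact: geometric_sum_le.
Qed.

(** One squaring reduces the degree by one; [expr_sum_le] carries the remaining power 2^d inside the
    sum over h. Differencing shortens the sums, so the length l is kept apart from the fixed range L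
    of h. Powers of L stand on both sides in place of the exponent 2^d - d - 1. *)
Lemma weyl_differencing (d : nat) : exists2 A : R, 0 < A &
  forall (L l : nat) c f, (l <= L)%N -> weyl_class d c f ->
  L%:R ^+ d.+1 * normc (expsum f l) ^+ (2 ^ d) <=
  A * L%:R ^+ (2 ^ d) * weyl_majorant (geom_bound L) L d c.
Proof.
elim: d => [|d [A A0 IHd]].
  exists 1 => // L l c f lL [b fE] /=; rewrite !expr1 mul1r ler_wpM2l //.
  exact: expsum_linear_le fE.
exists (2 ^+ (2 ^ d) * A) => [|L l c f lL fP]; first by rewrite mulr_gt0 // exprn_gt0.
rewrite [(2 ^ d.+1)%N]expnS !exprM exprS.
pose x (h : 'I_L) := normc (expsum (fun k => f (k + h)%N - f k) (l - h)).
have x0 h : 0 <= x h by exact: normc_ge0.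
have sx0 : 0 <= \sum_(h < L) x h by rewrite sumr_ge0.
have L0 n : 0 <= L%:R ^+ n :> R by exact: exprn_ge0.
apply: (@le_trans _ _ (L%:R * L%:R ^+ d.+1 * (2 * \sum_(h < L) x h) ^+ (2 ^ d))).
  rewrite ler_wpM2l ?mulr_ge0 // lerXn2r ?nnegrE ?sqr_ge0 ?mulr_ge0 //.
  exact: sqr_normc_expsum_le.
rewrite exprMn.
apply: (@le_trans _ _ (L%:R ^+ d.+1 * 2 ^+ (2 ^ d) *
    (L%:R ^+ (2 ^ d) * \sum_(h < L) x h ^+ (2 ^ d)))).
  have -> : L%:R * L%:R ^+ d.+1 * (2 ^+ (2 ^ d) * (\sum_h x h) ^+ (2 ^ d)) =
    (L%:R ^+ d.+1 * 2 ^+ (2 ^ d)) * (L%:R * (\sum_h x h) ^+ (2 ^ d)) :> R by ring.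
  by rewrite ler_wpM2l ?mulr_ge0 ?exprn_ge0 //; exact: expr_sum_le.
apply: (@le_trans _ _ (2 ^+ (2 ^ d) * L%:R ^+ (2 ^ d) *
   \sum_(h < L) (L%:R ^+ d.+1 * x h ^+ (2 ^ d)))).
  by rewrite -mulr_sumr le_eqVlt; apply/orP; left; apply/eqP; ring.
apply: (@le_trans _ _ (2 ^+ (2 ^ d) * L%:R ^+ (2 ^ d) *
   \sum_(h < L) (A * L%:R ^+ (2 ^ d) *
      weyl_majorant (geom_bound L) L d (d.+2%:R * c * h%:R)))).
  rewrite ler_wpM2l ?mulr_ge0 ?exprn_ge0 //; apply: ler_sum => h _.
  apply: IHd; last exact: fP.
  exact: leq_trans (leq_subr _ _) lL.
rewrite -mulr_sumr /= -exprM le_eqVlt; apply/orP; left; apply/eqP.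
by rewrite mulnC exprM -[_ ^+ 2 in RHS]/(_ * _); ring.
Qed.

Lemma weyl_class_eq (d : nat) c c' f g : c = c' -> f =1 g ->
  weyl_class d c f -> weyl_class d c' g.
Proof. by move=> -> /funext ->. Qed.

(** By Taylor's formula the difference by h is the polynomial [q] in k, of degree one less, and only
    the term i = 1 reaches its top coefficient. *)
Lemma weyl_class_horner (d : nat) (p : {poly R}) : (size p <= d.+2)%N ->
  weyl_class d p`_d.+1 (fun k => p.[k%:R]).
Proof.
elim: d p => [|d IHd] p sp /=.
  exists p`_0 => k; rewrite (horner_coef_wide _ sp) !big_ord_recr big_ord0 /=.
  by rewrite add0r expr0 mulr1 expr1 mulrC.
move=> h; pose q := \sum_(1 <= i < d.+3) (h%:R ^+ i) *: p^`N(i).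
have sq : (size q <= d.+2)%N.
  apply: (leq_trans (size_sum _ _ _)); apply/bigmax_leqP_seq => i.
  rewrite mem_index_iota => /andP[i1 _] _.
  apply: leq_trans (size_scale_leq _ _) _.
  apply: leq_trans (size_poly _ _) _; lia.
apply: weyl_class_eq (IHd q sq) => [|k].
  rewrite /q coef_sum big_ltn // big_nat big1 ?addr0 => [|i /andP[i1 _]].
    by rewrite coefZ coef_nderivn expr1 bin1 -mulr_natl; ring.
  rewrite coefZ coef_nderivn nth_default ?mul0rn ?mulr0 //.
  by apply: leq_trans sp _; lia.
have pE : p.[k%:R + h%:R] = \sum_(0 <= i < d.+3) p^`N(i).[k%:R] * h%:R ^+ i.
  by rewrite (nderiv_taylor_wide (mulrC _ _) sp) big_mkord.
rewrite natrD pE big_ltn // nderivn0 expr0 mulr1 [RHS]addrC addKr.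
rewrite /q horner_sum; apply: eq_bigr => i _.
by rewrite hornerZ mulrC.
Qed.

Lemma weyl_class_monomial (d : nat) c y :
  weyl_class d c (fun k => c * (y + k%:R) ^+ d.+1).
Proof.
pose q : {poly R} := ('X - (- y)%:P) ^+ d.+1.
have sq : size q = d.+2 by rewrite size_exp_XsubC.
apply: weyl_class_eq (@weyl_class_horner d (c *: q) _) => [|k|].
- have : lead_coef q = 1 by apply/monicP; exact/monic_exp/monicXsubC.
  by rewrite coefZ lead_coefE sq /= => ->; rewrite mulr1.
- by rewrite hornerZ horner_exp hornerXsubC opprK addrC.
- by apply: leq_trans (size_scale_leq _ _) _; rewrite sq.
Qed.

End WeylDifferencing.

(** * Sums of geometric bounds along arithmetic progressions, and Weyl's inequality *)

Section WeylInequality.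
Variable R : realType.
Implicit Types (b : R -> R) (c : R).

Local Notation normc := ComplexField.Normc.normc.

Lemma weyl_majorant_triv b (L d : nat) c : (forall c, b c <= L%:R) ->
  weyl_majorant b L d c <= L%:R ^+ d.+1.
Proof.
move=> bL; elim: d c => [|d IHd] c /=; first by rewrite expr1.
apply: (@le_trans _ _ (\sum_(h < L) L%:R ^+ d.+1)); first exact: ler_sum.
by rewrite sumr_const card_ord [leRHS]exprS mulr_natl.
Qed.

(** Tuples with a zero entry are bounded trivially and give d L^d. The nonzero ones are collected by
    their product, one factor at a time, each step costing a divisor count D. *)
Lemma weyl_majorant_le b (L d : nat) (D c : R) : (0 < L)%N ->
  (forall c, 0 <= b c) -> (forall c, b c <= L%:R) ->
  (forall k, (0 < k <= L ^ d)%N -> (size (divisors k))%:R <= D) ->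
  weyl_majorant b L d c <= d%:R * L%:R ^+ d +
    D ^+ d * \sum_(1 <= m < (L ^ d).+1) b ((d.+1)`!%:R * c * m%:R).
Proof.
move=> L0 b0 bL; elim: d c => [|d IHd] c dD /=.
  by rewrite !expr0 mulr1 add0r mul1r big_nat1 factS fact0 mul1r mulr1.
have D0 : 0 <= D by apply: le_trans (dD 1%N _) => //; rewrite expn_gt0 L0.
have {}IHd c' : weyl_majorant b L d c' <= d%:R * L%:R ^+ d +
    D ^+ d * \sum_(1 <= m < (L ^ d).+1) b ((d.+1)`!%:R * c' * m%:R).
  apply: IHd => k /andP[k0 kL]; apply: dD.
  by rewrite k0 (leq_trans kL) // leq_pexp2l.
rewrite -(big_mkord xpredT (fun h => weyl_majorant b L d (d.+2%:R * c * h%:R))).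
rewrite big_ltn // mulr0.
pose g k := b ((d.+2)`!%:R * c * k%:R).
apply: (@le_trans _ _ (L%:R ^+ d.+1 + \sum_(1 <= h < L) (d%:R * L%:R ^+ d +
    D ^+ d * \sum_(1 <= m < (L ^ d).+1) g (h * m)%N))).
  apply: lerD; first exact: weyl_majorant_triv.
  apply: ler_sum => h _.
  apply: le_trans (IHd _) _.
  rewrite le_eqVlt; apply/orP; left; apply/eqP; congr (_ + _ * _).
  apply: eq_bigr => m _; rewrite /g; congr b.
  by rewrite [(d.+2)`!]factS !natrM; ring.
rewrite big_split /= -!mulr_sumr sumr_const_nat -[in leRHS]natr1 mulrDl mul1r.
rewrite [in leRHS](addrC _ (L%:R ^+ d.+1)) -!addrA lerD2l.
apply: lerD.
  rewrite ler_wpM2l // -[leLHS]mulr_natl exprS ler_wpM2r ?exprn_ge0 //.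

  by rewrite ler_nat leq_subr.
rewrite exprSr -mulrA ler_wpM2l ?exprn_ge0 // expnS.
apply: sum_products_le => [k|k Hk]; first exact: b0.
by apply: dD; rewrite expnS.
Qed.

(** The term k = 0 is 0^-1 = 0, so this is the harmonic number of index n - 1. *)
Definition harmonic_sum (n : nat) : R := \sum_(k < n) k%:R^-1.

Lemma harmonic_sum_ge0 n : 0 <= harmonic_sum n.
Proof. by rewrite sumr_ge0 // => k _; rewrite invr_ge0. Qed.

Lemma harmonic_sum_pred (n : nat) :
  \sum_(k < n) (k.-1)%:R^-1 <= harmonic_sum n.
Proof.
case: n => [|n]; first by rewrite /harmonic_sum !big_ord0.
by rewrite big_ord_recl /= invr0 add0r /harmonic_sum big_ord_recr lerDl /= invr_ge0.
Qed.

Lemma harmonic_sum_rev (n : nat) :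
  \sum_(k < n) (n - k.+2)%:R^-1 <= harmonic_sum n.
Proof.
apply: le_trans (harmonic_sum_pred n).
rewrite (reindex_inj rev_ord_inj) /= ler_sum // => k _.
rewrite (_ : (n - (n - k.+1).+2)%N = k.-1) //.
by have := ltn_ord k; lia.
Qed.

Lemma harmonic_sum_le (n : nat) : (0 < n)%N -> harmonic_sum n <= 1 + ln n%:R.
Proof.
case: n => // n _.
apply: (@le_trans _ _ (harmonic_sum n.+2)).
  by rewrite [leRHS]big_ord_recr lerDl /= invr_ge0.
elim: n => [|n IHn].
  by rewrite /harmonic_sum !big_ord_recr big_ord0 /= invr0 ln1 invr1 !add0r addr0.
rewrite /harmonic_sum big_ord_recr /= -/(harmonic_sum n.+2).
have h : (n.+2%:R : R)^-1 < 1 by rewrite invf_lt1 // ltr1n.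
have : ln (1 + - n.+2%:R^-1) <= - n.+2%:R^-1 :> R.
  by apply: le_ln1Dx; rewrite ltrN2.
have -> : 1 + - n.+2%:R^-1 = n.+1%:R / n.+2%:R :> R.
  have : n.+2%:R != 0 :> R by rewrite pnatr_eq0.
  by rewrite -[n.+2%:R]natr1 => n0; field.
rewrite ln_div ?posrE //.
move: IHn {h}; set a := ln _; set b := ln _; set H := harmonic_sum _; set x := _^-1.
by move: a b H x => a b H x; lra.
Qed.

(* For [k] the residue of [u + a l] modulo [q], this dominates [geom_bound] at
   every point within [2 / q] of [k / q]; the truncated subtractions turn the
   out-of-range terms into [0^-1 = 0]. *)
Definition residue_bound (L q k : nat) : R :=
  L%:R * (k < 2)%:R + L%:R * (q <= k.+2)%:R +
  q%:R * (k.-1)%:R^-1 + q%:R * (q - k.+2)%:R^-1.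

Lemma sum_residue_bound_le (L q : nat) :
  \sum_(k < q) residue_bound L q k <= 4 * L%:R + 2 * q%:R * harmonic_sum q.
Proof.
rewrite /residue_bound !big_split /= -!mulr_sumr.
have H1 : \sum_(k < q) (k < 2)%:R <= 2 :> R.
  case: q => [|[|q]]; first by rewrite big_ord0.
    by rewrite big_ord_recr big_ord0 /= add0r ler1n.
  rewrite big_ord_recl big_ord_recl /= big1 ?addr0 // => i _.
have H2 : \sum_(k < q) (q <= k.+2)%:R <= 2 :> R.
  apply: le_trans H1; rewrite (reindex_inj rev_ord_inj) /= ler_sum // => k _.
  by rewrite ler_nat; have := ltn_ord k; case: leqP => //; lia.
have := ler_wpM2l (ler0n R L) H1; have := ler_wpM2l (ler0n R L) H2.
have := ler_wpM2l (ler0n R q) (harmonic_sum_pred q).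
have := ler_wpM2l (ler0n R q) (harmonic_sum_rev q).
lra.
Qed.

(** The window places x at distance at least (k - 1)/q from 0 and (q - k - 2)/q from 1. Where one of
    these is not positive, the trivial bound L is used; elsewhere [sinpi_inv_le] applies. *)
Lemma geom_bound_le_residue (L q k : nat) (x : R) : (0 < q)%N -> (k < q)%N ->
  - q%:R^-1 <= x - k%:R / q%:R <= 2 / q%:R ->
  geom_bound L x <= residue_bound L q k.
Proof.
move=> q0 kq; set y := x - _ => /andP[y1 y2].
have Q0 : 0 < q%:R :> R by rewrite ltr0n.
have p1 : 0 <= q%:R * (k.-1)%:R^-1 :> R by rewrite mulr_ge0 ?invr_ge0.
have p2 : 0 <= q%:R * (q - k.+2)%:R^-1 :> R by rewrite mulr_ge0 ?invr_ge0.
have L0 : 0 <= L%:R :> R by [].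
rewrite /residue_bound.
have [k2|k2] := ltnP k 2.
  apply: le_trans (geom_bound_le _ _) _; rewrite mulr1 -!addrA lerDl.
  by rewrite !addr_ge0 // mulr_ge0.
have [qk|qk] := leqP q k.+2.
  apply: le_trans (geom_bound_le _ _) _; rewrite mulr1 mulr0 add0r -!addrA lerDl.
  by rewrite addr_ge0.
rewrite !mulr0 !add0r.
have xE : x = y + k%:R / q%:R by rewrite /y subrK.
have x1 : (k.-1)%:R / q%:R <= x.
  rewrite xE -subn1 natrB; last lia.
  by rewrite mulrBl mul1r; lra.
have x2 : (q - k.+2)%:R / q%:R <= 1 - x.
  rewrite xE natrB; last lia.
  rewrite -[k.+2]addn2 natrD mulrBl divff ?gt_eqF // mulrDl; lra.
have k10 : 0 < (k.-1)%:R :> R by rewrite ltr0n; lia.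
have k20 : 0 < (q - k.+2)%:R :> R by rewrite ltr0n subn_gt0.
have x0 : 0 < x by apply: lt_le_trans x1; rewrite divr_gt0.
have x10 : 0 < 1 - x by apply: lt_le_trans x2; rewrite divr_gt0.
have s0 : 0 < `|sin (pi * x)|.
  rewrite normr_gt0 gt_eqF //; apply: sin_gt0_pi.
  by rewrite mulr_gt0 ?pi_gt0 //= -[ltRHS]mulr1 ltr_pM2l ?pi_gt0 //; lra.
apply: le_trans (geom_bound_le_inv _ s0) _.
apply: le_trans (sinpi_inv_le _) _; first by rewrite x0; lra.
by apply: lerD; rewrite -[_ * _]invrK lef_pV2 ?posrE ?invr_gt0 ?mulr_gt0 ?invr_gt0 //
  invfM invrK mulrC.
Qed.

(* A rational approximation [a / q] with error at most [1 / q ^ 2] spreads the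
   points [th + be l], [l < q], over all residues modulo [q]. *)
Lemma sum_geom_bound_block (L q : nat) (a : int) (be th : R) : (0 < q)%N ->
  coprimez a q -> `|be - a%:~R / q%:R| <= 1 / q%:R ^+ 2 ->
  \sum_(l < q) geom_bound L (th + be * l%:R) <=
  4 * L%:R + 2 * q%:R * harmonic_sum q.
Proof.
move=> q0 aq ab; apply: le_trans (sum_residue_bound_le L q).
have Q0 : 0 < q%:R :> R by rewrite ltr0n.
have q0' : q%:Z != 0 by rewrite eqz_nat -lt0n.
(* The point th + be l is close to (u + a l)/q: rounding th contributes an error in [0, 1/q] and
   approximating be one in [-1/q, 1/q], which is the asymmetric window of
   [geom_bound_le_residue]. *)
pose u := Num.floor (q%:R * th).
pose k (l : nat) := `|((u + a * l) %% q)%Z|%N.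
have kE l : (k l)%:Z = ((u + a * l) %% q)%Z by rewrite /k gez0_abs // modz_ge0.
have kq l : (k l < q)%N by rewrite -ltz_nat kE ltz_pmod.
pose h (l : 'I_q) := Ordinal (kq l).
have h_inj : injective h.
  move=> l l' /(congr1 val) /= /(congr1 Posz); rewrite !kE => /eqP.
  rewrite eqz_mod_dvd opprD addrACA subrr add0r -mulrBr Gauss_dvdzr; last first.
    by rewrite coprimez_sym.
  rewrite -eqz_mod_dvd !modz_nat eqz_nat !modn_small // => /eqP.
  exact: val_inj.
rewrite [leRHS](reindex_inj h_inj) /=; apply: ler_sum => l _.
have -> : geom_bound L (th + be * l%:R) =
    geom_bound L (th + be * l%:R - ((u + a * l) %/ q)%Z%:~R).
  by rewrite -[RHS](geom_boundDint _ _ ((u + a * l) %/ q)%Z) subrK.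
apply: geom_bound_le_residue => //.
have -> : (k l)%:R = (u%:~R + a%:~R * l%:R - ((u + a * l) %/ q)%Z%:~R * q%:R) :> R.
  rewrite -[(k l)%:R]/((k l)%:Z%:~R) kE /modz rmorphB rmorphD !rmorphM /=.
  by [].
have -> : th + be * l%:R - ((u + a * l) %/ q)%Z%:~R -
    (u%:~R + a%:~R * l%:R - ((u + a * l) %/ q)%Z%:~R * q%:R) / q%:R =
    (q%:R * th - u%:~R) / q%:R + (be - a%:~R / q%:R) * l%:R.
  by field; rewrite gt_eqF.
have /andP[u1 u2] := floor_itv (q%:R * th); rewrite -/u in u1 u2.
have f1 : 0 <= (q%:R * th - u%:~R) / q%:R by rewrite divr_ge0 // subr_ge0.
have f2 : (q%:R * th - u%:~R) / q%:R <= 1 / q%:R.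
  rewrite ler_pM2r ?invr_gt0 //.
  by move: u2; rewrite intrD; lra.
have : `|(be - a%:~R / q%:R) * l%:R| <= 1 / q%:R.
  rewrite normrM normr_nat.
  apply: (@le_trans _ _ (1 / q%:R ^+ 2 * q%:R)).
    by apply: ler_pM => //; rewrite ler_nat ltnW.
  by rewrite expr2 le_eqVlt; apply/orP; left; apply/eqP; field; rewrite gt_eqF.
rewrite ler_norml => /andP[f3 f4].
have -> : 2 / q%:R = 1 / q%:R + 1 / q%:R :> R by lra.
move: f1 f2 f3 f4; rewrite !mul1r.
by set A := _ / _; set B := _ * _; set Q := _^-1; lra.
Qed.

Lemma sum_blocks (F : nat -> R) (K q : nat) :
  \sum_(0 <= m < K * q) F m = \sum_(i < K) \sum_(l < q) F (i * q + l)%N.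
Proof.
elim: K => [|K IHK]; first by rewrite big_geq // big_ord0.
rewrite big_ord_recr /= -IHK mulSn addnC (@big_cat_nat _ _ _ (K * q)) ?leq_addr //=.
congr (_ + _); rewrite -{1}[(K * q)%N]add0n big_addn addnC addnK big_mkord.
by apply: eq_bigr => l _; rewrite addnC.
Qed.

Lemma sum_geom_bound_le (L q Z : nat) (a : int) (be : R) : (0 < q)%N ->
  coprimez a q -> `|be - a%:~R / q%:R| <= 1 / q%:R ^+ 2 ->
  \sum_(1 <= m < Z.+1) geom_bound L (be * m%:R) <=
  (Z%:R / q%:R + 1) * (4 * L%:R + 2 * q%:R * harmonic_sum q).
Proof.
move=> q0 aq ab; have Q0 : 0 < q%:R :> R by rewrite ltr0n.
set B := 4 * _ + _.
have B0 : 0 <= B by rewrite addr_ge0 ?mulr_ge0 ?harmonic_sum_ge0.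
apply: (@le_trans _ _ (\sum_(0 <= m < (Z %/ q).+1 * q) geom_bound L (be * m%:R))).
  rewrite [leRHS](@big_cat_nat _ _ _ 1) //=; last by rewrite muln_gt0 q0.
  rewrite [X in _ <= _ + X](@big_cat_nat _ _ _ Z.+1) //=; last exact: ltn_ceil.
  rewrite addrCA lerDl addr_ge0 // sumr_ge0 // => *; exact: geom_bound_ge0.
rewrite sum_blocks; apply: (@le_trans _ _ (\sum_(i < (Z %/ q).+1) B)).
  apply: ler_sum => i _; apply: le_trans (sum_geom_bound_block L (be * (i * q)%N%:R) q0 aq ab).
  by rewrite le_eqVlt; apply/orP; left; apply/eqP; apply: eq_bigr => l _; rewrite natrD mulrDr.
rewrite sumr_const card_ord -[leLHS]mulr_natl ler_wpM2r // -natr1 lerD2r.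
by rewrite ler_pdivlMr // -natrM ler_nat leq_divM.
Qed.

(* Every large [L] is within an arbitrarily small power of a denominator of a
   good approximation of [c]; this is all that is used of the Khinchin-Levy
   property. *)
Definition well_approx c : Prop :=
  forall de : R, 0 < de -> exists L0 : nat, forall L : nat, (L0 <= L)%N ->
  exists q : nat, exists a : int,
    [/\ (0 < q <= L)%N, L%:R `^ (1 - de) <= q%:R, coprimez a q &
        `|c - a%:~R / q%:R| <= 1 / q%:R ^+ 2].

Lemma size_divisors_le (K : nat) : (0 < K)%N -> exists2 C : R, 0 < C &
  forall n : nat, (0 < n)%N -> (size (divisors n))%:R <= C * n%:R `^ K%:R^-1.
Proof.
move=> K0; have KR : K%:R != 0 :> R by rewrite pnatr_eq0 -lt0n.
pose C : nat := ((K ^ K) ^ (2 ^ K))%N.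
exists (C%:R `^ K%:R^-1) => [|n n0].
  by rewrite powR_gt0 // ltr0n !expn_gt0 K0.
rewrite -powRM //.
have -> : (size (divisors n))%:R = ((size (divisors n))%:R ^+ K) `^ K%:R^-1 :> R.
  by rewrite -powR_mulrn // -powRrM mulfV // powRr1.
apply: ge0_ler_powR; rewrite ?nnegrE ?invr_ge0 ?mulr_ge0 ?exprn_ge0 //.
by rewrite -natrX -natrM ler_nat size_divisors_expn_le.
Qed.

Lemma harmonic_sum_powR (K n : nat) : (0 < K)%N -> (0 < n)%N ->
  harmonic_sum n <= (1 + K%:R) * n%:R `^ K%:R^-1.
Proof.
move=> K0 n0; apply: le_trans (harmonic_sum_le n0) _.
have KR : 0 < K%:R :> R by rewrite ltr0n.
have n1 : 1 <= n%:R :> R by rewrite ler1n.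
have p1 : 1 <= n%:R `^ K%:R^-1 :> R.
  by rewrite -[leLHS](powRr0 n%:R) ler_powR // invr_ge0 ltW.
have : ln (n%:R `^ K%:R^-1) < n%:R `^ K%:R^-1 :> R.
  by apply: ln_sublinear; apply: lt_le_trans p1.
rewrite ln_powR -(ltr_pM2l KR) mulVKf ?gt_eqF //.
rewrite mulrDl mul1r; set l := ln _; set p := powR _ _ in p1 *; set k := K%:R * p.
by move: l p p1 k => l p p1 k; lra.
Qed.

Lemma powRD_gt0 (x r s : R) : 0 < x -> x `^ (r + s) = x `^ r * x `^ s.
Proof. by move=> x0; rewrite powRD // (gt_eqF x0) implybT. Qed.

Lemma powR_root (x y : R) (n : nat) : (0 < n)%N -> 0 <= x ->
  x ^+ n <= y -> x <= y `^ n%:R^-1.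
Proof.
move=> n0 x0 xy; have nR : n%:R != 0 :> R by rewrite pnatr_eq0 -lt0n.
have -> : x = (x ^+ n) `^ n%:R^-1 by rewrite -powR_mulrn // -powRrM mulfV // powRr1.
have y0 : 0 <= y by apply: le_trans xy; exact: exprn_ge0.
by apply: ge0_ler_powR; rewrite ?nnegrE ?invr_ge0 ?exprn_ge0.
Qed.

(** Trades the factor (d+1)! of the slope for a longer range, so that rational approximations of c
    itself can be used. *)
Lemma sum_geom_bound_multiples (L Z h : nat) c : (0 < h)%N ->
  \sum_(1 <= m < Z.+1) geom_bound L (h%:R * c * m%:R) <=
  \sum_(1 <= k < (h * Z).+1) geom_bound L (c * k%:R).
Proof.
move=> h0; pose g k := geom_bound L (c * k%:R).
have g0 k : 0 <= g k by exact: geom_bound_ge0.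
apply: (@le_trans _ _ (\sum_(1 <= m < Z.+1) g (h * m)%N)).
  rewrite le_eqVlt; apply/orP; left; apply/eqP; apply: eq_bigr => m _.
  by rewrite /g natrM; congr geom_bound; ring.
apply: le_trans (sum_multiples_le Z h0 g0) _.
rewrite big_mkcond /=; apply: ler_sum => k _; case: ifP => // _; exact: g0.
Qed.

(** X is the unit of loss. Each of the d divisor counts is at most C X^d, the harmonic sum costs one
    more X, and replacing L by q costs another: d^2 + 2 in all. *)
Lemma weyl_majorant_geom_le (d L q K : nat) (a : int) (C c X : R) :
  (0 < d)%N -> (0 < K)%N -> (0 < q <= L)%N -> X = L%:R `^ K%:R^-1 ->
  L%:R <= q%:R * X -> coprimez a q ->
  `|c - a%:~R / q%:R| <= 1 / q%:R ^+ 2 -> 0 <= C ->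
  (forall n : nat, (0 < n)%N -> (size (divisors n))%:R <= C * n%:R `^ K%:R^-1) ->
  weyl_majorant (geom_bound L) L d c <=
  (d%:R + C ^+ d * (2 * (d.+1)`!%:R * (4 + 2 * (1 + K%:R)))) *
  L%:R ^+ d * X ^+ (d ^ 2).+2.
Proof.
move=> d0 K0 /andP[q0 qL] XE LqX aq ab C0 HC.
have KR : 0 < K%:R :> R by rewrite ltr0n.
have L1 : (0 < L)%N := leq_trans q0 qL.
have LR : 0 < L%:R :> R by rewrite ltr0n.
have LR1 : 1 <= L%:R :> R by rewrite ler1n.
have qR : 0 < q%:R :> R by rewrite ltr0n.
have qLR : q%:R <= L%:R :> R by rewrite ler_nat.
have X1 : 1 <= X.
  by rewrite XE -[leLHS](powRr0 L%:R) ler_powR // invr_ge0 ltW.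
have X0 : 0 <= X by lra.
have DP k : (0 < k <= L ^ d)%N -> (size (divisors k))%:R <= C * X ^+ d.
  move=> /andP[k0 kL]; apply: le_trans (HC k k0) _; rewrite ler_wpM2l //.
  have -> : X ^+ d = (L%:R ^+ d) `^ K%:R^-1.
    by rewrite XE -powR_mulrn ?powR_ge0 // powRAC powR_mulrn.
  by apply: ge0_ler_powR; rewrite ?nnegrE ?invr_ge0 ?exprn_ge0 // -natrX ler_nat.
apply: le_trans (weyl_majorant_le c L1 (geom_bound_ge0 L) (geom_bound_le L) DP) _.
pose F : R := (d.+1)`!%:R; rewrite -/F.
have F1 : 1 <= F by rewrite ler1n fact_gt0.
have S1 := sum_geom_bound_multiples L (L ^ d) c (fact_gt0 d.+1).
have S2 := sum_geom_bound_le L ((d.+1)`! * L ^ d) q0 aq ab.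
set S := \sum_(1 <= m < _) _ in S1 *.
pose P : R := L%:R ^+ d.
have LP : L%:R <= P by rewrite /P -[leLHS]expr1 ler_weXn2l.
have P0 : 0 < P by apply: lt_le_trans LP.
have Hq : harmonic_sum q <= (1 + K%:R) * X.
  apply: le_trans (harmonic_sum_powR K0 q0) _; rewrite ler_wpM2l ?addr_ge0 // XE.
  by apply: ge0_ler_powR; rewrite ?nnegrE ?invr_ge0.
have B1 : 4 * L%:R + 2 * q%:R * harmonic_sum q <= L%:R * (4 + 2 * (1 + K%:R)) * X.
  have h1 : 4 * L%:R <= 4 * L%:R * X by rewrite ler_peMr.
  have h2 : 2 * q%:R * harmonic_sum q <= 2 * L%:R * ((1 + K%:R) * X).
    by apply: ler_pM; rewrite ?mulr_ge0 ?harmonic_sum_ge0 ?ler_wpM2l.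
  by apply: le_trans (lerD h1 h2) _; rewrite le_eqVlt; apply/orP; left; apply/eqP; ring.
have B2 : ((d.+1)`! * L ^ d)%N%:R / q%:R + 1 <= 2 * F * P / q%:R.
  rewrite natrM natrX -/F -/P.
  have : 1 <= F * P / q%:R.
    rewrite ler_pdivlMr // mul1r; apply: le_trans qLR _; apply: le_trans LP _.
    by rewrite ler_peMl // ltW.
  by rewrite -[2 * F * P]mulrA -[2 * _ / _]mulrA; set u := F * P / _; lra.
have c0 : 0 <= 4 + 2 * (1 + K%:R) :> R by rewrite addr_ge0 ?mulr_ge0 ?addr_ge0.
have SB : S <= 2 * F * (4 + 2 * (1 + K%:R)) * P * X ^+ 2.
  apply: le_trans (le_trans S1 S2) _.
  apply: (@le_trans _ _ (2 * F * P / q%:R * (L%:R * (4 + 2 * (1 + K%:R)) * X))).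
    by apply: ler_pM; rewrite ?addr_ge0 ?divr_ge0 ?mulr_ge0 ?harmonic_sum_ge0.
  apply: (@le_trans _ _ (2 * F * P / q%:R * (q%:R * X * (4 + 2 * (1 + K%:R)) * X))).
    rewrite ler_wpM2l ?divr_ge0 ?mulr_ge0 ?(le_trans _ F1) ?(ltW P0) //.
    by rewrite ler_wpM2r // ler_wpM2r.
  by rewrite le_eqVlt; apply/orP; left; apply/eqP; field; rewrite gt_eqF.
have XX : 1 <= X ^+ (d ^ 2).+2 by exact: exprn_ege1.
apply: (@le_trans _ _ (d%:R * P * X ^+ (d ^ 2).+2 +
   (C * X ^+ d) ^+ d * (2 * F * (4 + 2 * (1 + K%:R)) * P * X ^+ 2))).
  apply: lerD; first by rewrite ler_peMr // mulr_ge0 // ltW.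
  by rewrite ler_wpM2l // exprn_ge0 // mulr_ge0 // exprn_ge0.
rewrite exprMn -exprM mulnn -[(d ^ 2).+2]addn2 exprD -/P.
by rewrite le_eqVlt; apply/orP; left; apply/eqP; ring.
Qed.

Theorem weyl_inequality (d : nat) c : (0 < d)%N -> well_approx c ->
  forall eps : R, 0 < eps -> exists2 C : R, 0 < C & forall (L : nat) (y : R),
  normc (expsum (fun k => c * (y + k%:R) ^+ d.+1) L) <=
  C * L%:R `^ (1 - (2 ^ d)%:R^-1 + eps).
Proof.
move=> d0 cP eps eps0.
(* Large enough that the total loss L^((d^2 + 2)/K) is at most L^eps. *)
pose K := (Num.truncn (((d ^ 2).+2)%:R / eps)).+1.
have K0 : (0 < K)%N by [].
have KR : 0 < K%:R :> R by rewrite ltr0n.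
pose de : R := K%:R^-1.
have de0 : 0 < de by rewrite invr_gt0.
have deK : (d ^ 2).+2%:R * de <= eps.
  rewrite /de ler_pdivrMr // mulrC -ler_pdivrMr //; apply/ltW.
  exact: truncnS_gt.
have [A A0 HA] := weyl_differencing R d.
have [C1 C10 HC1] := size_divisors_le K0.
have [L0 HL0] := cP de de0.
pose f y k : R := c * (y + k%:R) ^+ d.+1.
pose M := (2 ^ d)%N.
have M0 : (0 < M)%N by rewrite expn_gt0.
pose C2 : R := A * (d%:R + C1 ^+ d * (2 * (d.+1)`!%:R * (4 + 2 * (1 + K%:R)))).
have C20 : 0 < C2.
  have c0 : 0 < 4 + 2 * (1 + K%:R) :> R by move: (K%:R : R) KR => k; lra.
  by rewrite mulr_gt0 // ltr_wpDl // !mulr_gt0 ?exprn_gt0 ?ltr0n ?fact_gt0.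
have small (L : nat) (y : R) : normc (expsum (f y) L) <= L%:R by exact: normc_e_sum_le.
have M1 : 0 < M%:R :> R by rewrite ltr0n.
have Mi : M%:R^-1 <= 1 :> R by rewrite invf_le1 // ler1n.
(* The summand [L0] covers the lengths L <= L0 through the trivial bound L; the other one is the
   2^d-th root of the constant. *)
exists (C2 `^ M%:R^-1 + L0%:R) => [|L y].
  by rewrite ltr_wpDr // powR_gt0.
case: (posnP L) => [->|L1].
  by rewrite /expsum big_ord0 ComplexField.Normc.normc0 mulr_ge0 ?addr_ge0 ?powR_ge0.
have LR : 0 < L%:R :> R by rewrite ltr0n.
have LR1 : 1 <= L%:R :> R by rewrite ler1n.
rewrite mulrDl; have [LL0|LL0] := leqP L L0.
  apply: le_trans (small L y) _; apply: ler_wpDl.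
    by rewrite mulr_ge0 // powR_ge0.
  rewrite -[leLHS]mulr1 ler_pM ?ler_nat //.
  rewrite -[leLHS](powRr0 L%:R) ler_powR //.
  by rewrite -/M; set m := M%:R^-1 in Mi *; lra.
have [q [a [/andP[q0 qL] qLde aq ab]]] := HL0 L (ltnW LL0).
pose X := L%:R `^ de.
have qX : L%:R <= q%:R * X.
  apply: (@le_trans _ _ (L%:R `^ (1 - de) * X)); last by rewrite ler_wpM2r ?powR_ge0.
  by rewrite -powRD_gt0 // subrK powRr1 // ltW.
have H1 := weyl_majorant_geom_le d0 K0 (introT andP (conj q0 qL)) erefl qX aq ab (ltW C10) HC1.
have H2 := HA L L c (f y) (leqnn L) (weyl_class_monomial d c y).
have {H1 H2}H : normc (expsum (f y) L) ^+ M <=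
    C2 * L%:R `^ (M%:R - 1 + (d ^ 2).+2%:R * de).
  rewrite !powRD_gt0 // powR_inv1 ?(ltW LR) // powR_mulrn ?(ltW LR) //.
  rewrite [_ * de]mulrC powRrM powR_mulrn ?powR_ge0 // -/X.
  have Ld : 0 < L%:R ^+ d.+1 :> R by exact: exprn_gt0.
  rewrite -(ler_pM2l Ld); apply: le_trans H2 _.
  apply: le_trans (ler_wpM2l _ H1) _; first by rewrite mulr_ge0 ?exprn_ge0 // ltW.
  by rewrite /C2 /M [L%:R ^+ d.+1]exprS le_eqVlt; apply/orP; left; apply/eqP; field; rewrite gt_eqF.
apply: ler_wpDr; first by rewrite mulr_ge0 ?powR_ge0.
apply: le_trans (powR_root M0 (normc_ge0 _) H) _.
rewrite powRM ?powR_ge0 ?(ltW C20) // ler_wpM2l ?powR_ge0 // -powRrM ler_powR //.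
rewrite mulrDl mulrBl mulfV ?gt_eqF // mul1r lerD2l.
apply: le_trans deK; rewrite -[leRHS]mulr1 ler_wpM2l // mulr_ge0 //; exact: ltW.
Qed.

End WeylInequality.
(** * Rational approximation *)

Section RationalApproximation.
Variable R : realType.
Implicit Types (c de : R).

Lemma well_approxN c : well_approx c -> well_approx (- c).
Proof.
move=> cP de /cP[L0 H]; exists L0 => L /H[q [a [h1 h2 h3 h4]]].
exists q, (- a); split => //; first by rewrite coprimeNz.
by rewrite mulrNz mulNr -opprD normrN.
Qed.

(** Because 1 - de <= 1 / (1 + de). *)
Lemma powR_1B_le (x y de : R) : 1 <= x -> 0 <= y -> 0 < de ->
  x <= y `^ (1 + de) -> x `^ (1 - de) <= y.
Proof.
move=> x1 y0 de0 xy; have d1 : 0 < 1 + de by lra.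
apply: (@le_trans _ _ (x `^ (1 + de)^-1)).
  rewrite ler_powR // -[leRHS]mul1r ler_pdivlMr //; nra.
have -> : y = (y `^ (1 + de)) `^ (1 + de)^-1.
  by rewrite -powRrM mulfV ?gt_eqF // powRr1.
by apply: ge0_ler_powR; rewrite ?nnegrE ?invr_ge0 ?powR_ge0 //; lra.
Qed.

(** Take the last q_n <= L, which exists because q_n >= n. Then L < q_(n+1) <= q_n^(1+de). *)
Lemma khinchin_levy_well_approx c : khinchin_levy c -> well_approx c.
Proof.
move=> [_ [q [q_homo q0 q_growth qP]]] de de0.
have [Ne HNe] := q_growth de de0.
have qn n : (n <= q n)%N.
  by elim: n => // n IHn; apply: leq_ltn_trans IHn (q_homo _ _ _).
exists (q Ne.+1) => L LN.
pose P n := (q n <= L)%N.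
have Pub n : P n -> (n <= L)%N by apply: leq_trans.
case: (ex_maxnP (ex_intro P Ne.+1 LN) Pub) => n Pn nmax.
have [a aq ab] := qP n.
exists (q n), a; split => //; first by rewrite q0.
have nNe : (Ne < n)%N by exact: nmax.
have qL : (L < q n.+1)%N.
  by rewrite ltnNge; apply/negP => /nmax; rewrite ltnn.
have L1 : (0 < L)%N by apply: leq_trans Pn; exact: q0.
apply: powR_1B_le => //; first by rewrite ler1n.
by apply: le_trans (HNe n nNe); rewrite ler_nat ltnW.
Qed.

(** Pigeonhole: two of the L + 1 fractional parts of j c share one of L boxes. *)
Lemma dirichlet c (L : nat) : (0 < L)%N -> exists q : nat, exists a : int,
  (0 < q <= L)%N /\ `|q%:R * c - a%:~R| <= 1 / L%:R.
Proof.
move=> L0; have LR : 0 < L%:R :> R by rewrite ltr0n.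
pose fr (j : nat) : R := j%:R * c - (Num.floor (j%:R * c))%:~R.
have fr01 j : 0 <= fr j < 1.
  have /andP[] := floor_itv (j%:R * c); rewrite /fr intrD; lra.
pose g j := Num.truncn (L%:R * fr j).
have gE j : (g j)%:R <= L%:R * fr j < (g j).+1%:R.
  by apply: truncn_itv; rewrite mulr_ge0 //; case/andP: (fr01 j).
have gL j : (g j < L)%N.
  rewrite -(ltr_nat R); apply: le_lt_trans (proj1 (andP (gE j))) _.
  by rewrite -[ltRHS]mulr1 ltr_pM2l //; case/andP: (fr01 j).
pose f (j : 'I_L.+1) := Ordinal (gL j).
have /injectivePn[i0 [j0 ij0 fij0]] : ~~ injectiveb f.
  apply/negP => /injectiveP /leq_card; rewrite !card_ord ltnn //.
have [i [j [ij gij]]] : exists i j : 'I_L.+1, (i < j)%N /\ g i = g j.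
  have gg : g i0 = g j0 := congr1 val fij0.
  case: (ltngtP i0 j0) => [h|h|/val_inj h].
  - by exists i0, j0.
  - by exists j0, i0.
  - by rewrite h eqxx in ij0.
exists (j - i)%N, (Num.floor (j%:R * c) - Num.floor (i%:R * c)); split.
  by rewrite subn_gt0 ij /=; apply: leq_trans (leq_subr _ _) _; rewrite -ltnS.
rewrite natrB ?(ltnW ij) // rmorphB /=.
have -> : (j%:R - i%:R) * c -
    ((Num.floor (j%:R * c))%:~R - (Num.floor (i%:R * c))%:~R) = fr j - fr i.
  by rewrite /fr; ring.
rewrite ler_pdivlMr // -[X in _ * X](ger0_norm (ltW LR)) -normrM.
have := gE i; have := gE j; rewrite gij -natr1 mulrBl ler_norml.
rewrite ![fr _ * _]mulrC; set u := _ * fr j; set v := _ * fr i.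
by set w := _%:R; lra.
Qed.

Lemma dirichlet_coprime c (L : nat) : (0 < L)%N -> exists q : nat, exists a : int,
  [/\ (0 < q <= L)%N, coprimez a q & `|c - a%:~R / q%:R| <= 1 / (q%:R * L%:R)].
Proof.
move=> L0; have [q [a [/andP[q0 qL] Ha]]] := dirichlet c L0.
have LR : 0 < L%:R :> R by rewrite ltr0n.
pose g := gcdn `|a| q.
have g0 : (0 < g)%N by rewrite gcdn_gt0 q0 orbT.
have gR : 0 < g%:R :> R by rewrite ltr0n.
have qE : q = ((q %/ g) * g)%N by rewrite divnK // dvdn_gcdr.
have aE : a = (a %/ g)%Z * g by rewrite divzK // dvdzE /= dvdn_gcdl.
pose q' := (q %/ g)%N; pose a' := (a %/ g)%Z.
rewrite -/q' in qE; rewrite -/a' in aE.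
have q'0 : (0 < q')%N by rewrite /q' divn_gt0 // dvdn_leq // dvdn_gcdr.
have q'R : 0 < q'%:R :> R by rewrite ltr0n.
have q'q : (q' <= q)%N by exact: leq_div.
exists q', a'; split; first by rewrite q'0 (leq_trans q'q).
  rewrite /coprimez /gcdz; apply/eqP; congr Posz.
  have : (gcdn `|a'| q' * g = 1 * g)%N.
    by rewrite mul1n {2}/g [in RHS]aE [in RHS]qE abszM muln_gcdl.
  by move=> /eqP; rewrite eqn_pmul2r // => /eqP.
have -> : c - a'%:~R / q'%:R = (q%:R * c - a%:~R) / q%:R.
  rewrite aE qE natrM rmorphM /= -[(Posz g)%:~R]/(g%:R).
  by field; rewrite !gt_eqF.
rewrite normrM normfV normr_nat.
have qR : 0 < q%:R :> R by rewrite ltr0n.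
apply: (@le_trans _ _ (1 / L%:R / q%:R)); first by rewrite ler_wpM2r ?invr_ge0.
rewrite !mul1r -invfM lef_pV2 ?posrE ?mulr_gt0 // [leRHS]mulrC.
by rewrite ler_wpM2r // ler_nat.
Qed.

(* No coprimality here: a rational [c] violates this, since it is hit exactly
   by infinitely many unreduced fractions. *)
Definition eventually_far c de : Prop := exists Q0 : nat, forall q : nat,
  (Q0 < q)%N -> forall a : int, q%:R `^ (- (2 + de)) < `|c - a%:~R / q%:R|.

(** Dirichlet's q <= L satisfies |c - a/q| <= 1/(q L); if q is beyond the threshold, this exceeds
    q^-(2+de), so L < q^(1+de). *)
Lemma eventually_far_well_approx c :
  (forall de, 0 < de -> eventually_far c de) -> well_approx c.
Proof.
move=> cP de de0; have [Q0 HQ] := cP de de0.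
pose k := Q0.+1; have kR : 0 < k%:R :> R by rewrite ltr0n.
pose eta : R := (k%:R * k%:R) `^ (- (2 + de)).
have eta0 : 0 < eta by rewrite powR_gt0 // mulr_gt0.
exists (Num.truncn (eta^-1)).+1 => L LL.
have L1 : (0 < L)%N by apply: leq_trans LL.
have LR : 0 < L%:R :> R by rewrite ltr0n.
have Leta : 1 / L%:R < eta.
  rewrite mul1r -[ltRHS]invrK ltf_pV2 ?posrE ?invr_gt0 //.
  by apply: lt_le_trans (truncnS_gt _) _; rewrite ler_nat.
have [q [a [/andP[q0 qL] aq ab]]] := dirichlet_coprime c L1.
have qR : 0 < q%:R :> R by rewrite ltr0n.
exists q, a; split => //; first by rewrite q0.
  (* For q <= Q0 the unreduced fraction (k a)/(k q) has a denominator beyond [Q0], so |c - a/q| >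
     [eta], contrary to 1/L < [eta]. *)
  have [qQ|qQ] := leqP q Q0.
    have kq : (Q0 < k * q)%N by rewrite leq_pmulr.
    have := HQ (k * q)%N kq (k%:Z * a).
    rewrite natrM rmorphM /= -[(Posz k)%:~R]/(k%:R) -mulf_div divff ?gt_eqF // mul1r.
    have : eta <= (k%:R * q%:R) `^ (- (2 + de)).
      rewrite /eta !powRN lef_pV2 ?posrE ?powR_gt0 ?mulr_gt0 //.
      apply: ge0_ler_powR; rewrite ?nnegrE ?mulr_ge0 //; first lra.
      by rewrite ler_wpM2l // ler_nat ltnW // ltnS.
    have : 1 / (q%:R * L%:R) <= 1 / L%:R :> R.
      rewrite !mul1r lef_pV2 ?posrE ?mulr_gt0 // -[leLHS]mul1r ler_wpM2r //.
      by rewrite ler1n.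
    move: Leta ab; set A := powR _ _; lra.
  apply: powR_1B_le => //; first by rewrite ler1n.
  have := lt_le_trans (HQ q qQ a) ab; rewrite powRN mul1r ltf_pV2 ?posrE ?mulr_gt0 ?powR_gt0 //.
  rewrite (_ : 2 + de = 1 + (1 + de)); last lra.
  by rewrite powRD_gt0 // powRr1 // ltr_pM2l // => /ltW.
apply: le_trans ab _; rewrite !mul1r lef_pV2 ?posrE ?mulr_gt0 ?exprn_gt0 //.
by rewrite expr2 ler_pM2l // ler_nat.
Qed.

End RationalApproximation.

(** * Almost every t is admissible: Borel-Cantelli *)

Section MetricApproximation.
Variable R : realType.
Implicit Types (t s de : R).

Local Notation mu := (@lebesgue_measure R).

Lemma sum_powR_le de (K : nat) : 0 < de ->
  \sum_(k < K) k.+1%:R `^ (- (1 + de)) <= 1 + de^-1 :> R.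
Proof.
move=> de0; have di0 : 0 < de^-1 by rewrite invr_gt0.
(* Integral comparison, with the negative tail term kept so that the induction closes. *)
suff H : \sum_(k < K.+1) k.+1%:R `^ (- (1 + de)) <=
    1 + de^-1 * (1 - K.+1%:R `^ (- de)) :> R.
  apply: (@le_trans _ _ (\sum_(k < K.+1) k.+1%:R `^ (- (1 + de)))).
    by rewrite [leRHS]big_ord_recr lerDl powR_ge0.
  by apply: le_trans H _; rewrite lerD2l -[leRHS]mulr1 ler_wpM2l ?(ltW di0) ?gerBl ?powR_ge0.
elim: K => [|K IHK].
  by rewrite big_ord_recl big_ord0 /= !mulr1n powR1 subrr mulr0.
rewrite big_ord_recr /=; apply: le_trans (lerD IHK (lexx _)) _.
pose f (x : R) := de^-1 * x `^ (- de).
pose g (x : R) := K.+2%:R `^ (- (1 + de)) * x.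
have K1 : K.+1%:R <= K.+2%:R :> R by rewrite ler_nat.
have df (x : R) : K.+1%:R <= x <= K.+2%:R -> is_derive x 1 (- f) (x `^ (- (1 + de))).
  move=> /andP[Kx _]; have x0 : 0 < x by apply: lt_le_trans Kx.
  have h := is_derive1_powR (- de) x0.
  have h2 : is_derive x 1 (- f) (- (de^-1 *: (- de * x `^ (- de - 1)))).
    by apply: is_deriveN; exact: is_deriveZ.
  apply: is_derive_eq; rewrite /GRing.scale /= mulrA mulrN mulVf ?gt_eqF // mulN1r opprK.
  by congr powR; lra.
have dg (x : R) : K.+1%:R <= x <= K.+2%:R -> is_derive x 1 g (K.+2%:R `^ (- (1 + de))).
  by move=> _; rewrite /g; apply: is_derive_eq; rewrite /GRing.scale /= mulr1 ?mulr0 ?addr0.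
have := @derive_le _ g (- f) _ _ _ _ K1 dg df.
have gf (x : R) : K.+1%:R <= x <= K.+2%:R ->
    K.+2%:R `^ (- (1 + de)) <= x `^ (- (1 + de)) :> R.
  move=> /andP[Kx xK]; have x0 : 0 < x by apply: lt_le_trans Kx.
  rewrite !powRN lef_pV2 ?posrE ?powR_gt0 //.
  by apply: ge0_ler_powR; rewrite ?nnegrE ?(ltW x0) //; lra.
move=> /(_ gf); rewrite !fctE /f /g -mulrBr -natrB // subSnn mulr1.
by set u := powR _ _; set v := powR _ _; set w := powR _ _; lra.
Qed.

(* If [g] expands distances on [S] by a factor [k], the [t] in [S] with [g t]
   close to [a / q] fill at most one short interval, and Borel-Cantelli applies. *)
Lemma negligible_not_eventually_far (g : R -> R) (S : set R) (k B de : R) :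
  0 < k -> 0 < de ->
  (forall t s, S t -> S s -> k * `|t - s| <= `|g t - g s|) ->
  (forall t, S t -> `|g t| <= B) ->
  mu.-negligible [set t | S t /\ ~ eventually_far (g t) de].
Proof.
move=> k0 de0 gexp gB.
pose w (q : nat) : R := q%:R `^ (- (2 + de)).
have w0 q : 0 <= w q by exact: powR_ge0.
pose near (q : nat) (a : int) : set R := [set t | S t /\ `|g t - a%:~R / q%:R| <= w q].
(* Two points of [near q a] have values of g at most 2 w q apart, so the set lies within 2 w q / k
   of any of its points; [tau] picks one, with default 0 if there is none. *)
pose tau q a : R := xget 0 (near q a).
pose I q a : set R := [set` `[tau q a - 2 * w q / k, tau q a + 2 * w q / k]].
have nearI q a : near q a `<=` I q a.
  move=> t tq; have [Ss Hs] : near q a (tau q a) by apply: xgetPex; exists t.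
  case: tq => St Ht; rewrite /I /= in_itv /= -ler_distlC distrC.
  rewrite ler_pdivlMr // mulrC; apply: le_trans (gexp _ _ St Ss) _.
  have -> : g t - g (tau q a) =
    (g t - a%:~R / q%:R) - (g (tau q a) - a%:~R / q%:R) by ring.
  by apply: le_trans (ler_normB _ _) _; rewrite mulr_natl mulr2n; exact: lerD.
(* As w q <= 1 for q > 0, a fraction a/q close to g t has |a| <= A q. Hence [F n] needs only 2 A
   (n+1) + 1 numerators for the denominator n + 1, and its measure is O(n^-(1+de)), which is
   summable. *)
pose A := (Num.truncn (B + 1)).+1.
pose F (n : nat) : set R := \big[setU/set0]_(i < (2 * A * n.+1).+1)
  I n.+1 (i%:Z - (A * n.+1)%:Z).
have mI q a : measurable (I q a) by exact: measurable_itv.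
have muI q a : (mu (I q a) <= (4 * w q / k)%:E)%E.
  rewrite /I lebesgue_measure_itv /= lte_fin; case: ifP => _.
    by rewrite -EFinD lee_fin; set u := 2 * _ / _; rewrite (_ : 4 * w q / k = u + u) /u; lra.
  by rewrite lee_fin divr_ge0 ?mulr_ge0 // ltW.
have mF n : measurable (F n) by apply: bigsetU_measurable.
pose C : R := 3 * A%:R * 4 / k.
have C0 : 0 <= C by rewrite divr_ge0 ?mulr_ge0 // ltW.
have muF n : (mu (F n) <= (C * n.+1%:R `^ (- (1 + de)))%:E)%E.
  apply: le_trans (@Boole_inequality _ R _ mu
    (fun i : nat => I n.+1 (i%:Z - (A * n.+1)%:Z)) _ (fun i _ => mI _ _)) _.
  apply: (@le_trans _ _ (\sum_(i < (2 * A * n.+1).+1) (4 * w n.+1 / k)%:E)%E).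
    by apply: lee_sum => i _; exact: muI.
  rewrite sumEFin lee_fin sumr_const card_ord -[leLHS]mulr_natl.
  have -> : C * n.+1%:R `^ (- (1 + de)) = (3 * A%:R * n.+1%:R) * (4 * w n.+1 / k).
    rewrite /C /w (_ : - (2 + de) = - (1 + de) - 1); last lra.
    have kn : k != 0 by rewrite gt_eqF.
    have nn : n.+1%:R != 0 :> R by rewrite pnatr_eq0.
    rewrite powRD_gt0 // powR_inv1 //; set P := powR _ _.
    by move: (n.+1%:R : R) nn P => x xn P; field; rewrite kn.
  rewrite ler_wpM2r ?divr_ge0 ?mulr_ge0 ?(ltW k0) //.
  rewrite -!natrM ler_nat -addn1; lia.
have sumF : (\sum_(n <oo) mu (F n) < +oo)%E.
  apply: (@le_lt_trans _ _ (C * (1 + de^-1))%:E); last exact: ltry.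
  apply: lime_le; first by apply: is_cvg_nneseries.
  apply: nearW => n; rewrite big_mkord.
  apply: (@le_trans _ _ (\sum_(i < n) (C * i.+1%:R `^ (- (1 + de)))%:E)%E).
    by apply: lee_sum => i _; exact: muF.
  by rewrite sumEFin lee_fin -mulr_sumr ler_wpM2l // sum_powR_le.
have mlim : measurable (lim_sup_set F).
  apply: bigcap_measurable => // n _; exact: bigcup_measurable.
have := @lim_sup_set_cvg0 _ _ _ mu F mF sumF => /(negligibleP mu mlim).
apply: negligibleS => t [St /forallNP tfar] n _.
have /existsNP[q /not_implyP[nq /existsNP[a /negP]]] := tfar n.
rewrite -leNgt => Hqa; case: q nq Hqa => // q nq Hqa.
exists q => //=.
have tI : I q.+1 a t by apply: nearI.
have aA : (`|a|%N <= A * q.+1)%N.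
  have h1 : `|a%:~R / q.+1%:R| <= B + 1 :> R.
    have -> : a%:~R / q.+1%:R = g t - (g t - a%:~R / q.+1%:R) by ring.
    apply: le_trans (ler_normB _ _) _; apply: lerD; first exact: gB.
    apply: le_trans Hqa _; rewrite powRN invf_le1 ?powR_gt0 //.
    rewrite -[leLHS](powRr0 q.+1%:R) ler_powR ?ler1n //; lra.
  rewrite -(ler_nat R) natrM natr_absz intr_norm -ler_pdivrMr //.
  rewrite normrM normfV normr_nat in h1.
  by apply: le_trans h1 _; apply/ltW/truncnS_gt.
have [i iE] : exists i : nat, a + (A * q.+1)%:Z = i%:Z.
  by exists (absz (a + (A * q.+1)%:Z)); rewrite gez0_abs; lia.
have iL : (i < (2 * A * q.+1).+1)%N by lia.
rewrite /F -(bigcup_mkord _ (fun i => I q.+1 (i%:Z - (A * q.+1)%:Z))).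
by exists i => //=; rewrite -iE addrK.
Qed.

Definition c_const (d : nat) : R := d%:R ^+ d / d.+1%:R ^+ d.+1.

Lemma c_coefE (d : nat) t : c_coef t d.+1%:Z = c_const d / t ^+ d.
Proof.
rewrite /c_coef /c_const.
have -> : 1 - d.+1%:Z = - d%:Z by lia.
have -> : d.+1%:Z - 1 = d%:Z by lia.
rewrite -!exprnN -exprnP -[(d.+1%:Z)%:~R]/(d.+1%:R) -natr1 addrK natr1.
by rewrite -mulrA mulrC.
Qed.

Lemma c_const_gt0 (d : nat) : (0 < d)%N -> 0 < c_const d.
Proof. by move=> d0; rewrite divr_gt0 // exprn_gt0 ?ltr0n. Qed.

(** Here [sg] is the sign of t and s. Factor x^-d - y^-d as (y - x)/(x y) times a sum of nonnegative
    terms, one of which is x^-(d-1), and bound all inverses below by 1/(m+1). *)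
Lemma c_coef_expands (d m : nat) (sg t s : R) : (0 < d)%N -> `|sg| = 1 ->
  m.+1%:R^-1 <= sg * t <= m.+1%:R -> m.+1%:R^-1 <= sg * s <= m.+1%:R ->
  c_const d / m.+1%:R ^+ d.+1 * `|t - s| <=
  `|c_coef t d.+1%:Z - c_coef s d.+1%:Z|.
Proof.
move=> d0 sg1; have sg0 : sg != 0 by rewrite -normr_eq0 sg1 oner_eq0.
set x := sg * t; set y := sg * s => /andP[x1 x2] /andP[y1 y2].
have m0 : 0 < m.+1%:R :> R by [].
have x0 : 0 < x by apply: lt_le_trans x1; rewrite invr_gt0.
have y0 : 0 < y by apply: lt_le_trans y1; rewrite invr_gt0.
have tE : t = x / sg by rewrite /x mulrC mulKf.
have sE : s = y / sg by rewrite /y mulrC mulKf.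
clearbody x y.
have -> : `|t - s| = `|x - y|.
  by rewrite tE sE -mulrBl normrM normfV sg1 invr1 mulr1.
rewrite !c_coefE -mulrBr normrM (ger0_norm (ltW (c_const_gt0 d0))) -mulrA.
rewrite ler_wpM2l ?(ltW (c_const_gt0 d0)) //.
have -> : `|(t ^+ d)^-1 - (s ^+ d)^-1| = `|x^-1 ^+ d - y^-1 ^+ d|.
  rewrite tE sE !exprMn !invfM (exprVn sg) invrK -mulrBl normrM normrX sg1 expr1n mulr1.
  by rewrite !exprVn.
case: d d0 => // d _; rewrite subrXX normrM.
have -> : x^-1 - y^-1 = (y - x) * (x^-1 * y^-1).
  by field; rewrite !gt_eqF.
rewrite normrM (distrC y) -mulrA mulrC ler_wpM2l //.
have mx : m.+1%:R^-1 <= x^-1 by rewrite lef_pV2 ?posrE.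
have my : m.+1%:R^-1 <= y^-1 by rewrite lef_pV2 ?posrE.
have mi0 : 0 <= m.+1%:R^-1 :> R by rewrite invr_ge0.
have xi0 : 0 <= x^-1 by rewrite invr_ge0 ltW.
have yi0 : 0 <= y^-1 by rewrite invr_ge0 ltW.
rewrite -exprVn !exprS mulrA.
apply: ler_pM; rewrite ?mulr_ge0 ?exprn_ge0 //.
  by rewrite ger0_norm ?mulr_ge0 // ler_pM.
rewrite ger0_norm; last first.
  by rewrite sumr_ge0 // => i _; rewrite mulr_ge0 ?exprn_ge0.
rewrite big_ord_recl /= subn0 expr0 mulr1.
apply: (@le_trans _ _ (x^-1 ^+ d)); first by rewrite lerXn2r ?nnegrE.
by rewrite lerDl sumr_ge0 // => i _; rewrite mulr_ge0 ?exprn_ge0.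
Qed.

Lemma c_coef_le (d m : nat) (sg t : R) : (0 < d)%N -> `|sg| = 1 ->
  m.+1%:R^-1 <= sg * t -> `|c_coef t d.+1%:Z| <= c_const d * m.+1%:R ^+ d.
Proof.
move=> d0 sg1 h; have t1 : m.+1%:R^-1 <= `|t|.
  by apply: le_trans h _; apply: le_trans (ler_norm _) _; rewrite normrM sg1 mul1r.
have t0 : 0 < `|t| by apply: lt_le_trans t1; rewrite invr_gt0.
rewrite c_coefE normrM (ger0_norm (ltW (c_const_gt0 d0))).
rewrite ler_wpM2l ?(ltW (c_const_gt0 d0)) // normfV normrX -exprVn.
by rewrite lerXn2r ?nnegrE ?invr_ge0 // -[leRHS]invrK lef_pV2 ?posrE ?invr_gt0.
Qed.

(** The nonzero reals are a countable union of the sets [S m sg]. Countably many exponents 1/(k+1)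
    suffice, since [eventually_far] weakens as de grows. *)
Lemma ae_well_approx (d : nat) : (0 < d)%N ->
  {ae mu, forall t, t != 0 -> well_approx (c_coef t d.+1%:Z)}.
Proof.
move=> d0.
pose S (m : nat) (sg : R) : set R := [set t | m.+1%:R^-1 <= sg * t <= m.+1%:R].
pose N (m k : nat) (sg : R) : set R :=
  [set t | S m sg t /\ ~ eventually_far (c_coef t d.+1%:Z) k.+1%:R^-1].
have NN m k sg : `|sg| = 1 -> mu.-negligible (N m k sg).
  move=> sg1; apply: (@negligible_not_eventually_far _ _
    (c_const d / m.+1%:R ^+ d.+1) (c_const d * m.+1%:R ^+ d)).
  - by rewrite divr_gt0 ?c_const_gt0 // exprn_gt0.
  - by rewrite invr_gt0.
  - by move=> t s St Ss; exact: (c_coef_expands d0 sg1 St Ss).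
  - by move=> t /andP[St _]; exact: (c_coef_le d0 sg1 St).
have : mu.-negligible (\bigcup_m \bigcup_k (N m k 1 `|` N m k (-1))).
  apply: negligible_bigcup => m; apply: negligible_bigcup => k.
  by apply: negligibleU; apply: NN; rewrite ?normrN normr1.
apply: negligibleS => t /= /not_implyP[t0 tP].
have [m tm] : exists m : nat, m.+1%:R^-1 <= `|t| <= m.+1%:R.
  exists (maxn (Num.truncn `|t|) (Num.truncn `|t|^-1)).
  have tp : 0 < `|t| by rewrite normr_gt0.
  apply/andP; split.
    rewrite -[leRHS]invrK lef_pV2 ?posrE ?invr_gt0 //.
    by apply: le_trans (ltW (truncnS_gt _)) _; rewrite ler_nat ltnS leq_maxr.
  by apply: le_trans (ltW (truncnS_gt _)) _; rewrite ler_nat ltnS leq_maxl.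
have [k tk] : exists k, ~ eventually_far (c_coef t d.+1%:Z) k.+1%:R^-1.
  apply: contrapT => /forallNP H; apply: tP; apply: eventually_far_well_approx => de de0.
  have /contrapT[Q0 HQ] := H (Num.truncn de^-1).
  exists Q0 => q Qq a; apply: le_lt_trans (HQ q Qq a).
  rewrite ler_powR ?ler1n ?(leq_ltn_trans _ Qq) // lerN2 lerD2l.
  by rewrite -[leRHS]invrK lef_pV2 ?posrE ?invr_gt0 // ltW // truncnS_gt.
exists m => //; exists k => //.
have [t1|t1] := leP 0 t.
  by left; split => //; rewrite /S /= mul1r; rewrite ger0_norm in tm.
by right; split => //; rewrite /S /= mulN1r; rewrite ltr0_norm in tm.
Qed.

End MetricApproximation.
(** * Fresnel integrals and stationary phase *)

Section Antiderivative.
Variable R : realType.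

Lemma antiderivative_ray (f : R -> R) : continuous f ->
  exists F : R -> R, forall x : R, -1 < x -> is_derive x 1 F (f x).
Proof.
move=> cf.
pose F (x : R) := (\int[@lebesgue_measure R]_(t in `[-1, x]%classic) f t)%R.
exists F => x x1.
have xu : x < x + 1 by rewrite ltrDl.
have fi : (@lebesgue_measure R).-integrable `[-1, x + 1]%classic (EFin \o f).
  apply: continuous_compact_integrable; first exact: segment_compact.
  exact: continuous_subspaceT.
have [dF F'] := continuous_FTC1_closed xu fi x1 (cf x).
by rewrite derive1E in F'; exact: DeriveDef dF F'.
Qed.

(** Glues at 0 the primitive on x > -1 and a reflected one on x < 1. They agree on (-1, 1), which
    gives the derivative at 0. *)
Lemma antiderivative (f : R -> R) : continuous f ->
  exists F : R -> R, forall x : R, is_derive x 1 F (f x).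
Proof.
move=> cf; have [F dF] := antiderivative_ray cf.
have cfN : continuous (f \o -%R).
  by move=> x; apply: continuous_comp; [exact: opp_continuous|exact: cf].
have [G dG] := antiderivative_ray cfN.
pose H x := G 0 - G (- x).
have dH (x : R) : x < 1 -> is_derive x 1 H (f x).
  move=> x1; have h : is_derive (- x) 1 G (f x).
    by have := dG (- x); rewrite /= opprK; apply; lra.
  rewrite /H; apply: is_derive_eq; rewrite /GRing.scale /=; lra.
pose F0 x := F x - F 0.
have dF0 (x : R) : -1 < x -> is_derive x 1 F0 (f x).
  by move=> x1; have h := dF x x1; rewrite /F0; apply: is_derive_eq; lra.
have FH (x : R) : -1 < x < 1 -> F0 x = H x.
  move=> /andP[x1 x2]; pose D y := F0 y - H y.
  have dD (y : R) : -1 < y < 1 -> is_derive y 1 D 0.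
    move=> /andP[y1 y2]; have h1 := dF0 y y1; have h2 := dH y y2.
    by rewrite /D; apply: is_derive_eq; lra.
  have D0 : D 0 = 0 by rewrite /D /F0 /H oppr0 !subrr.
  have [x0|x0] := leP 0 x.
    have : `|D x - D 0| <= 0 * (x - 0).
      apply: (derive_norm_le_cst (f' := fun=> 0)) => // y /andP[y0 yx].
        by apply: dD; lra.
      by rewrite normr0.
    by rewrite D0 subr0 mul0r normr_le0 /D => /eqP; lra.
  have : `|D 0 - D x| <= 0 * (0 - x).
    apply: (derive_norm_le_cst (f' := fun=> 0)) => [|y /andP[y0 yx]|]; first lra.
      by apply: dD; lra.
    by move=> *; rewrite normr0.
  by rewrite D0 sub0r mul0r normrN normr_le0 /D => /eqP; lra.
exists (fun x => if 0 < x then F0 x else H x) => x.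
have [x0|x0] := ltP 0 x.
  apply: near_eq_is_derive (dF0 x _); last lra.
  near=> y; rewrite ifT //.
  by near: y; exact: lt_nbhsr.
have [x1|x1] := ltP x 0.
  apply: near_eq_is_derive (dH x _); last lra.
  near=> y; rewrite ifF //; apply/negbTE; rewrite -leNgt ltW //.
  by near: y; exact: lt_nbhsl.
have -> : x = 0 by lra.
apply: near_eq_is_derive (dH 0 _); last lra.
near=> y; case: ifPn => // _; rewrite FH //; apply/andP; split.
  by near: y; apply: lt_nbhsr; lra.
by near: y; apply: lt_nbhsl; lra.
Unshelve. all: by end_near.
Qed.

End Antiderivative.
Section Fresnel.
Variable R : realType.
Implicit Types (th x X Y : R).

(** Integration by parts: [G] is the boundary term, and the derivative of [Phi - G] is dominated by
    that of [E]. *)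
Lemma fresnel_cauchy th (Phi : R -> R) X Y :
  (forall x, is_derive x 1 Phi (cos (th - 2 * pi * x ^+ 2))) ->
  0 < Y -> Y <= X -> `|Phi X - Phi Y| <= Y^-1.
Proof.
move=> dPhi Y0 YX; have pi2 := pi_ge2 R.
have X0 : 0 < X by apply: lt_le_trans YX.
pose G x : R := - (sin (th - 2 * pi * x ^+ 2) * (4 * pi)^-1 * x^-1).
pose E x : R := - ((4 * pi)^-1 * x^-1).
pose s x : R := sin (th - 2 * pi * x ^+ 2).
have dV x : 0 < x -> is_derive x 1 (fun y : R => y^-1) (- x ^- 2).
  move=> x0; have h := @is_deriveV R id x 1 1 (lt0r_neq0 x0) (is_derive_id _ _).
  by apply: is_derive_eq; rewrite /GRing.scale /= mulr1.
have dH x : Y <= x <= X -> is_derive x 1 (Phi - G) (- (s x * (4 * pi)^-1 * x ^- 2)).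
  move=> /andP[Yx _]; have x0 : 0 < x by apply: lt_le_trans Yx.
  have h := dV x x0; have h2 := dPhi x.
  rewrite /G /s; apply: is_derive_eq; rewrite /GRing.scale /=.
  by rewrite ?mulr0 ?addr0 ?sub0r; field; rewrite ?lt0r_neq0 //; lra.
have dE x : Y <= x <= X -> is_derive x 1 E ((4 * pi)^-1 * x ^- 2).
  move=> /andP[Yx _]; have x0 : 0 < x by apply: lt_le_trans Yx.
  have h := dV x x0; rewrite /E; apply: is_derive_eq; rewrite /GRing.scale /=.
  by rewrite ?mulr0 ?addr0; ring.
have pp : 0 <= 4 * pi :> R by lra.
have pi0 : 0 <= (4 * pi)^-1 :> R by rewrite invr_ge0.
have := derive_norm_le YX dH dE.
have hs x : Y <= x <= X -> `|- (s x * (4 * pi)^-1 * x ^- 2)| <= (4 * pi)^-1 * x ^- 2.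
  move=> _; rewrite normrN !normrM (ger0_norm pi0) normfV normrX real_normK ?num_real //.
  by rewrite -mulrA ler_piMl ?mulr_ge0 ?invr_ge0 ?sqr_ge0 ?pp // /s sin_max.
move=> /(_ hs); rewrite !fctE.
have Yi : 0 <= Y^-1 by rewrite invr_ge0 ltW.
have Xi : 0 <= X^-1 by rewrite invr_ge0 ltW.
have GX : `|G X| <= (4 * pi)^-1 * X^-1.
  rewrite /G normrN !normrM (ger0_norm pi0) (ger0_norm Xi).
  by rewrite -mulrA ler_piMl ?mulr_ge0 ?invr_ge0 ?(ltW X0) ?pp // sin_max.
have GY : `|G Y| <= (4 * pi)^-1 * Y^-1.
  rewrite /G normrN !normrM (ger0_norm pi0) (ger0_norm Yi).
  by rewrite -mulrA ler_piMl ?mulr_ge0 ?invr_ge0 ?(ltW Y0) ?pp // sin_max.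
have pi8 : (4 * pi)^-1 * Y^-1 <= 8^-1 * Y^-1.
  by rewrite ler_wpM2r ?invr_ge0 ?(ltW Y0) // lef_pV2 ?posrE; lra.
have XY : (4 * pi)^-1 * X^-1 <= (4 * pi)^-1 * Y^-1.
  by rewrite ler_wpM2l // lef_pV2 ?posrE.
have Xi' : 0 <= (4 * pi)^-1 * X^-1 by rewrite mulr_ge0 // invr_ge0 ltW.
move: GX GY; rewrite /E !ler_norml.
set u := (4 * pi)^-1 * X^-1 in XY Xi' *; set v := (4 * pi)^-1 * Y^-1 in pi8 XY *.
lra.
Qed.

(** By [fresnel_cauchy] every Phi X - 1/X is below every Phi Y + 1/Y, so the supremum of the former
    is the limit, with its rate. *)
Lemma fresnel_limit th (Phi : R -> R) :
  (forall x, is_derive x 1 Phi (cos (th - 2 * pi * x ^+ 2))) ->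
  exists k : R, forall X, 0 < X -> `|Phi X - k| <= X^-1.
Proof.
move=> dPhi.
pose A := [set y | exists2 X, 0 < X & y = Phi X - X^-1].
have AB X Y : 0 < X -> 0 < Y -> Phi X - X^-1 <= Phi Y + Y^-1.
  move=> X0 Y0; have Xi : 0 <= X^-1 by rewrite invr_ge0 ltW.
  have Yi : 0 <= Y^-1 by rewrite invr_ge0 ltW.
  have [XY|XY] := leP X Y.
    have := fresnel_cauchy dPhi X0 XY; rewrite ler_norml; lra.
  have := fresnel_cauchy dPhi Y0 (ltW XY); rewrite ler_norml; lra.
have A0 : A !=set0 by exists (Phi 1 - 1^-1); exists 1.
exists (sup A) => X X0; rewrite ler_norml; apply/andP; split.
  have : sup A <= Phi X + X^-1 by apply: ge_sup => // _ [Y Y0 ->]; exact: AB.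
  lra.
have : Phi X - X^-1 <= sup A.
  apply: ub_le_sup; last by exists X.
  by exists (Phi 1 + 1^-1) => _ [Y Y0 ->]; exact: AB.
lra.
Qed.

Lemma fresnel_odd th (Phi : R -> R) :
  (forall x, is_derive x 1 Phi (cos (th - 2 * pi * x ^+ 2))) -> Phi 0 = 0 ->
  forall x, Phi (- x) = - Phi x.
Proof.
move=> dPhi Phi0 x; pose D y := Phi y + Phi (- y).
have dD y : is_derive y (1 : R) D 0.
  have h1 := dPhi y; have h2 := dPhi (- y).
  by rewrite /D; apply: is_derive_eq; rewrite /GRing.scale /= sqrrN; ring.
have := is_derive_0_is_cst x 0 dD; rewrite /D oppr0 Phi0 addr0; lra.
Qed.

Lemma one_sub_cos_le x : 0 <= x -> 1 - cos x <= x.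
Proof.
move=> x0; pose f (y : R) := 1 - cos y.
have df (y : R) : is_derive y 1 f (sin y).
  by rewrite /f; apply: is_derive_eq; ring.
have := @derive_le _ f id sin (fun=> 1) 0 x x0 (fun y _ => df y)
  (fun y _ => is_derive_id _ _) (fun y _ => sin_le1 y).
rewrite /f /= cos0; lra.
Qed.

(* Integrating [sin] by parts against [1 - cos] leaves a nonnegative integrand,
   which keeps the Fresnel sine integral away from 0. *)
Lemma fresnel_sin_ge (Phi : R -> R) X :
  (forall x, is_derive x 1 Phi (sin (2 * pi * x ^+ 2))) -> Phi 0 = 0 ->
  1 <= X -> 1 / 100 <= Phi X.
Proof.
move=> dPhi Phi0 X1; have pi2 := pi_ge2 R; have pi4 := pihalf_lt2 R.
pose c x : R := cos (2 * pi * x ^+ 2).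
pose F x : R := (1 - c x) * (4 * pi)^-1 * x^-1.
pose T' x : R := (1 - c x) * (4 * pi)^-1 * x ^- 2.
have dT x : 0 < x -> is_derive x 1 (Phi - F) (T' x).
  move=> x0; have h := @is_deriveV R id x 1 1 (lt0r_neq0 x0) (is_derive_id _ _).
  have h2 := dPhi x; rewrite /F /T' /c; apply: is_derive_eq; rewrite /GRing.scale /=.
  by field; rewrite ?lt0r_neq0 //; lra.
have pp : 0 <= 4 * pi :> R by lra.
have pi0 : 0 <= (4 * pi)^-1 :> R by rewrite invr_ge0.
have T'0 x : 0 <= T' x.
  by rewrite !mulr_ge0 ?invr_ge0 ?sqr_ge0 ?pp // subr_ge0 cos_le1.
have mT x y : 0 < x -> x <= y -> (Phi - F) x <= (Phi - F) y.
  move=> x0 xy; refine (@derive_ge0_le R (Phi - F) T' x y xy _ (fun z _ => T'0 z)).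
  by move=> z /andP[xz _]; apply: dT; exact: lt_le_trans xz.
(* [Phi - F] is nondecreasing only on x > 0, as [F] contains 1/x; starting at 1/50 costs at most
   1/100. *)
have h1 : - (1 / 100) <= (Phi - F) (1 / 50).
  rewrite !fctE.
  have : Phi 0 <= Phi (1 / 50).
    have l : 0 <= 1 / 50 :> R by lra.
    refine (@derive_ge0_le R Phi _ 0 (1 / 50) l (fun z _ => dPhi z) _) => z /andP[z0 z1].
    by apply: sin_ge0_pi; have := pi_gt0 R; nra.
  have : 1 - c (1 / 50) <= 2 * pi * (1 / 50) ^+ 2 by apply: one_sub_cos_le; nra.
  rewrite Phi0 /F => hc; have : (1 - c (1 / 50)) * (4 * pi)^-1 * (1 / 50)^-1 <= 1 / 100.
    have -> : (1 / 50)^-1 = 50 :> R by field.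
    by rewrite mulrAC ler_pdivrMr; lra.
  lra.
(* On [1/2, 4/5] the angle 2 pi x^2 stays between pi/2 and 3 pi/2, so 1 - cos >= 1; with pi <= 4 the
   gain is more than 2/100. *)
have h2 : 3 / 10 * (4 * 4 * (16 / 25))^-1 <= (Phi - F) (4 / 5) - (Phi - F) (1 / 2).
  pose g x : R := (4 * 4 * (16 / 25))^-1 * x.
  have -> : 3 / 10 * (4 * 4 * (16 / 25))^-1 = g (4 / 5) - g (1 / 2) by rewrite /g; lra.
  apply: (@derive_le _ g (Phi - F) (fun=> (4 * 4 * (16 / 25))^-1) T'); first lra.
  - by move=> x _; rewrite /g; apply: is_derive_eq; rewrite /GRing.scale /=; ring.
  - by move=> x /andP[x1 _]; apply: dT; lra.
  move=> x /andP[x1 x2].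
  have -> : T' x = (1 - c x) * (4 * pi * x ^+ 2)^-1 by rewrite /T' [in RHS]invfM mulrA.
  have [xx1 xx2] : 1 / 4 <= x ^+ 2 /\ x ^+ 2 <= 16 / 25 by nra.
  have c0 : c x <= 0.
    rewrite /c -[2 * _ * _](subrK pi) cosDpi oppr_le0; apply: cos_ge0_pihalf.
    by apply/andP; split; nra.
  have q0 : 0 < 4 * pi * x ^+ 2 by rewrite mulr_gt0 ?exprn_gt0; lra.
  apply: (@le_trans _ _ (4 * pi * x ^+ 2)^-1); last by rewrite ler_peMl ?invr_ge0 ?(ltW q0) //; lra.
  rewrite lef_pV2 ?posrE //; nra.
have h3 := mT (1 / 50) (1 / 2); have h4 := mT (4 / 5) X.
have F0 : 0 <= F X by rewrite !mulr_ge0 ?invr_ge0 ?pp ?subr_ge0 ?cos_le1 //; lra.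
move: h1 h2 h3 h4; rewrite !fctE; lra.
Qed.

(** By the addition formula the cases th = 0 and th = pi/2 suffice; [kc] and [ks] are the half-line
    Fresnel integrals. *)
Lemma fresnel : exists kc ks : R, 0 < ks /\ forall th, exists Phi : R -> R,
  [/\ forall x, is_derive x 1 Phi (cos (th - 2 * pi * x ^+ 2)),
      forall x, Phi (- x) = - Phi x &
      forall X, 0 < X -> `|Phi X - (cos th * kc + sin th * ks)| <= 2 * X^-1].
Proof.
have normal th : exists2 Phi : R -> R,
    (forall x, is_derive x 1 Phi (cos (th - 2 * pi * x ^+ 2))) & Phi 0 = 0.
  have [|F dF] := @antiderivative R (fun x => cos (th - 2 * pi * x ^+ 2)).
    move=> x; apply: (@derive_continuous _ _
      (- sin (th - 2 * pi * x ^+ 2) * - (2 * pi * (2 * x)))).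
    by apply: is_derive_eq; rewrite /GRing.scale /=; ring.
  exists (fun x => F x - F 0) => [x|]; last by rewrite subrr.
  by have h := dF x; apply: is_derive_eq; rewrite subr0.
have [Pc dPc Pc0] := normal 0; have [Ps dPs Ps0] := normal (pi / 2).
have [kc Hc] := fresnel_limit dPc; have [ks Hs] := fresnel_limit dPs.
exists kc, ks; split.
  (* At 1000 the distance to the limit, at most 1/1000, cannot cancel 1/100. *)
  have h : 1 / 100 <= Ps 1000.
    apply: fresnel_sin_ge => // [x|]; last lra.
    by have := dPs x; rewrite -opprB cosN cosBpihalf.
  have := Hs 1000; rewrite ler_norml => /(_ _) h2; have {}h2 : Ps 1000 - ks <= 1000^-1.
    by have /andP[] := h2 (ltr0n _ _).
  have : 1000^-1 < 1 / 100 :> R by lra.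
  lra.
move=> th; exists (fun x => cos th * Pc x + sin th * Ps x).
have ths x : cos (th - 2 * pi * x ^+ 2) =
    cos th * cos (0 - 2 * pi * x ^+ 2) + sin th * cos (pi / 2 - 2 * pi * x ^+ 2).
  by rewrite sub0r cosN -[pi / 2 - _]opprB cosN cosBpihalf cosB.
split=> [x|x|X X0].
- have h1 := dPc x; have h2 := dPs x.
  by apply: is_derive_eq; rewrite /GRing.scale /= ths; ring.
- by rewrite (fresnel_odd dPc Pc0) (fresnel_odd dPs Ps0); ring.
have -> : cos th * Pc X + sin th * Ps X - (cos th * kc + sin th * ks) =
  cos th * (Pc X - kc) + sin th * (Ps X - ks) by ring.
apply: le_trans (ler_normD _ _) _; rewrite !normrM mulr_natl mulr2n.
apply: lerD.
  by apply: le_trans (Hc X X0); rewrite ler_piMl // cos_max.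
by apply: le_trans (Hs X X0); rewrite ler_piMl // sin_max.
Qed.

End Fresnel.

(** * Stationary phase with error O(1/la) *)

Section StationaryPhase.
Variable R : realType.
Implicit Types (f g : R -> R) (w : R).

(* [0, 5] contains the values of [v / v_n] for [v] in the interval of
   integration. *)
Definition bounded_C1 f : Prop := exists (f' : R -> R) (C : R),
  forall w, 0 <= w <= 5 ->
  [/\ is_derive w 1 f (f' w), `|f w| <= C & `|f' w| <= C].

Lemma bounded_C1_cst (c : R) : bounded_C1 (fun=> c).
Proof.
exists (fun=> 0), `|c| => w _; split => //; first exact: is_derive_cst.
by rewrite normr0.
Qed.

Lemma bounded_C1D f g : bounded_C1 f -> bounded_C1 g ->
  bounded_C1 (fun w => f w + g w).
Proof.
move=> [f' [Cf Hf]] [g' [Cg Hg]].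
exists (fun w => f' w + g' w), (Cf + Cg) => w /[dup] /Hf[h1 h2 h3] /Hg[k1 k2 k3].
split; first by apply: is_deriveD.
  by apply: le_trans (ler_normD _ _) _; exact: lerD.
by apply: le_trans (ler_normD _ _) _; exact: lerD.
Qed.

Lemma bounded_C1M f g : bounded_C1 f -> bounded_C1 g ->
  bounded_C1 (fun w => f w * g w).
Proof.
move=> [f' [Cf Hf]] [g' [Cg Hg]].
have Cf0 : 0 <= Cf by have [|_ h _] := Hf 0; [lra|exact: le_trans h].
have Cg0 : 0 <= Cg by have [|_ h _] := Hg 0; [lra|exact: le_trans h].
exists (fun w => f w * g' w + g w * f' w), (2 * Cf * Cg) => w.
move=> /[dup] /Hf[h1 h2 h3] /Hg[k1 k2 k3]; split.
- exact: is_deriveM.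
- have : `|f w| * `|g w| <= Cf * Cg by rewrite ler_pM.
  by rewrite normrM; nra.
apply: le_trans (ler_normD _ _) _; rewrite !normrM -mulrA mulr_natl mulr2n.
apply: lerD; first by rewrite ler_pM.
by rewrite mulrC ler_pM.
Qed.

Lemma bounded_C1V f (c : R) : bounded_C1 f -> 0 < c ->
  (forall w, 0 <= w <= 5 -> c <= f w) -> bounded_C1 (fun w => (f w)^-1).
Proof.
move=> [f' [C Hf]] c0 cf.
have C0 : 0 <= C by have [|_ h _] := Hf 0; [lra|exact: le_trans h].
have ci0 : 0 <= c^-1 by rewrite invr_ge0 ltW.
exists (fun w => - (f w) ^- 2 * f' w), (c^-1 + c ^- 2 * C) => w ww.
have [h1 h2 h3] := Hf w ww; have fc := cf w ww.
have f0 : 0 < f w by apply: lt_le_trans fc.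
have fi : (f w)^-1 <= c^-1 by rewrite lef_pV2.
have c2 : 0 <= c ^- 2 * C by rewrite mulr_ge0 // invr_ge0 exprn_ge0 // ltW.
have fi0 : 0 <= (f w)^-1 by rewrite invr_ge0 ltW.
split; first by apply: is_deriveV => //; rewrite gt_eqF.
  by rewrite ger0_norm //; apply: le_trans fi _; rewrite lerDl.
apply: ler_wpDl => //; rewrite normrM normrN.
rewrite ler_pM // -exprVn normrX ger0_norm // -exprVn.
by rewrite lerXn2r ?nnegrE.
Qed.

Lemma bounded_C1_sqrt f (c : R) : bounded_C1 f -> 0 < c ->
  (forall w, 0 <= w <= 5 -> c <= f w) -> bounded_C1 (fun w => Num.sqrt (f w)).
Proof.
move=> [f' [C Hf]] c0 cf.
have C0 : 0 <= C by have [|_ h _] := Hf 0; [lra|exact: le_trans h].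
have s0 : 0 < Num.sqrt c by rewrite sqrtr_gt0.
exists (fun w => (2 * Num.sqrt (f w))^-1 * f' w), (Num.sqrt C + (2 * Num.sqrt c)^-1 * C).
move=> w ww; have [h1 h2 h3] := Hf w ww; have fc := cf w ww.
have f0 : 0 < f w by apply: lt_le_trans fc.
have k0 : 0 <= (2 * Num.sqrt c)^-1 * C by rewrite mulr_ge0 // invr_ge0; lra.
split.
- have h := is_derive1_sqrt f0.
  exact: (@is_derive1_comp _ Num.sqrt f w _ _ h h1).
- rewrite ger0_norm ?sqrtr_ge0 //; apply: ler_wpDr => //.
  by apply: ler_wsqrtr; apply: le_trans h2; exact: ler_norm.
apply: ler_wpDl; first exact: sqrtr_ge0.
have si : (2 * Num.sqrt (f w))^-1 <= (2 * Num.sqrt c)^-1.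
  rewrite lef_pV2 ?posrE ?mulr_gt0 ?sqrtr_gt0 // ler_wpM2l //; exact: ler_wsqrtr.
have s1 : 0 <= (2 * Num.sqrt (f w))^-1 by rewrite invr_ge0 mulr_ge0 // sqrtr_ge0.
by rewrite normrM ger0_norm // ler_pM.
Qed.

Lemma horner_bounded (p : {poly R}) : exists C : R, forall w, 0 <= w <= 5 -> `|p.[w]| <= C.
Proof.
exists (\sum_(i < size p) `|p`_i| * 5 ^+ i) => w /andP[w0 w5].
rewrite horner_coef; apply: le_trans (ler_norm_sum _ _ _) _.
apply: ler_sum => i _; rewrite normrM ler_wpM2l // normrX ger0_norm //.
by rewrite lerXn2r ?nnegrE.
Qed.

Lemma bounded_C1_horner (p : {poly R}) : bounded_C1 (horner p).
Proof.
have [C1 H1] := horner_bounded p; have [C2 H2] := horner_bounded p^`().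
have C10 : 0 <= C1 by apply: le_trans (H1 0 _) => //; lra.
have C20 : 0 <= C2 by apply: le_trans (H2 0 _) => //; lra.
exists (horner p^`()), (C1 + C2) => w ww; split.
- exact: is_derive_poly.
- by apply: le_trans (H1 w ww) _; rewrite lerDl.
- by apply: le_trans (H2 w ww) _; rewrite lerDr.
Qed.

(** Multiplying the polynomial for d by X and adding (d+1)(X - 1)^2 gives the one for d + 1. *)
Lemma subX_square_factor (d : nat) : exists2 A : {poly R},
  'X^(d.+1) - d.+1%:R *: 'X + d%:R%:P = ('X - 1) ^+ 2 * A &
  forall w, 0 <= w -> d%:R <= A.[w].
Proof.
elim: d => [|d [A AE A0]].
  exists 0 => [|w _]; last by rewrite horner0.
  by rewrite mulr0 expr1 scale1r subrr add0r.
exists ('X * A + d.+1%:R%:P) => [|w w0].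
  rewrite mulrDr mulrCA -AE -!mul_polyC !exprS -![d.+2%:R]natr1 -![d.+1%:R]natr1 !polyCD.
  by set D := (d%:R)%:P; rewrite polyC1; ring.
rewrite hornerD hornerM hornerX hornerC lerDr mulr_ge0 //.
by apply: le_trans (A0 w w0).
Qed.

(** The dual phase measured in units of its stationary point, with sign and scale changed (see
    [dual_phaseE]); the constant makes it vanish doubly at 1. *)
Definition phase_poly (d : nat) : {poly R} :=
  d.+1%:R^-1 *: 'X^(d.+1) - 'X + (1 - d.+1%:R^-1)%:P.

(* With [p = phase_poly d = (X - 1)^2 P] and [p' = (X - 1) Q], the signed square
   root [s = (w - 1) sqrt P] of [p] satisfies [s' = Q / (2 sqrt P)]. *)
Lemma phase_poly_factor (d : nat) : (0 < d)%N -> exists P Q : {poly R},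
  [/\ phase_poly d = ('X - 1) ^+ 2 * P,
      (phase_poly d)^`() = ('X - 1) * Q,
      Q = 2%:P * P + ('X - 1) * P^`(),
      forall w, 0 <= w -> 1 / 2 <= P.[w] &
      forall w, 0 <= w -> 1 <= Q.[w] ].
Proof.
move=> d0; have [A AE A0] := subX_square_factor d.
have dR : d.+1%:R != 0 :> R by rewrite pnatr_eq0.
have dR0 : 0 < d.+1%:R :> R by rewrite ltr0n.
pose P := d.+1%:R^-1 *: A; pose Q := 2%:P * P + ('X - 1) * P^`().
have pP : phase_poly d = ('X - 1) ^+ 2 * P.
  rewrite /P /phase_poly -!mul_polyC mulrCA -AE -mul_polyC mulrDr mulrBr mulrA.
  rewrite -!polyCM mulVf // mul1r; congr (_ + _%:P).
  by rewrite -natr1 in dR *; field.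
have p'Q : (phase_poly d)^`() = ('X - 1) * Q.
  rewrite pP derivM expr2 derivM derivB derivX derivC subr0 /Q polyCD polyC1; ring.
have QE : Q = \sum_(i < d) 'X^i.
  have X10 : 'X - 1 != 0 :> {poly R} by rewrite -polyC1 polyXsubC_eq0.
  apply: (mulfI X10); rewrite -p'Q -subrX1 /phase_poly.
  rewrite derivD derivB derivZ derivXn derivX derivC addr0 /=.
  have dE : d.+1%:R^-1 *+ d.+1 = 1 :> R by rewrite -[LHS]mulr_natr mulVf.
  by rewrite -scalerMnr scalerMnl dE scale1r.
exists P, Q; split=> // w w0.
  rewrite hornerZ [leRHS]mulrC ler_pdivlMr //; apply: le_trans (A0 w w0).
  rewrite mul1r mulrC ler_pdivrMr // -natrM ler_nat; lia.
rewrite QE; case: d d0 {A AE A0 dR dR0 P Q pP p'Q QE} => // d _.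
rewrite big_ord_recl hornerD expr0 hornerC lerDl horner_sum sumr_ge0 // => i _.
by rewrite hornerXn exprn_ge0.
Qed.

(** The variable S = (w - 1) sqrt P turns the phase into a pure square, so F is compared with a
    rescaled Fresnel function. The mismatch of amplitudes vanishes at w = 1, hence is divisible by
    the derivative of the phase, and one integration by parts gains 1/la. *)
Lemma stationary_phase (d : nat) : (0 < d)%N ->
  exists k1 k2 C : R, [/\ 0 < k2, 0 < C &
  forall (la a b th : R) (F : R -> R), 0 < la -> 0 <= a <= 1 / 2 -> 2 <= b <= 5 ->
  (forall w, 0 <= w <= 5 ->
     is_derive w 1 F (cos (th - 2 * pi * (la * (phase_poly d).[w])))) ->
  `|F b - F a - (cos th * k1 + sin th * k2) / Num.sqrt la| <= C / la].
Proof.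
move=> d0; have [P [Q [pP p'Q QP P12 Q1]]] := phase_poly_factor d0.
have X1 w : ('X - 1 : {poly R}).[w] = w - 1 by rewrite -polyC1 hornerXsubC.
have QE w : Q.[w] = 2 * P.[w] + (w - 1) * P^`().[w].
  by rewrite QP hornerD !hornerM hornerC X1.
have pE w : (phase_poly d).[w] = (w - 1) ^+ 2 * P.[w].
  by rewrite pP hornerM horner_exp X1.
have [kc [ks [ks0 fres]]] := fresnel R.
pose sg := Num.sqrt P.[1].
have P1 : 1 / 2 <= P.[1] by apply: P12.
have sg0 : 0 < sg by rewrite sqrtr_gt0; lra.
have sg2 : sg ^+ 2 = P.[1] by rewrite sqr_sqrtr //; lra.
(* The root at 1 comes from Q(1) = 2 P(1). *)
have [T TE] : exists T : {poly R}, (4 * P.[1]) *: P - Q ^+ 2 = T * ('X - 1%:P).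
  apply/factor_theorem/eqP.
  by rewrite hornerD hornerN hornerZ horner_exp QE subrr mul0r addr0; ring.
pose S w := (w - 1) * Num.sqrt P.[w].
(* The quotient of 1 - Q / (2 sg sqrt P) by (w - 1) Q, rationalised so that w = 1 is no longer
   singular (see [mE]). *)
pose m w := T.[w] * (Q.[w]^-1 * ((2 * sg * Num.sqrt P.[w] + Q.[w])^-1 *
   (2 * sg * Num.sqrt P.[w])^-1)).
have sqP w : 0 <= w -> 1 / 2 <= Num.sqrt P.[w].
  move=> w0; rewrite -[leLHS]ger0_norm ?divr_ge0 // -sqrtr_sqr ler_wsqrtr //.
  by apply: le_trans (P12 w w0); lra.
have nP := bounded_C1_horner P; have nQ := bounded_C1_horner Q.
have nsP : bounded_C1 (fun w => 2 * sg * Num.sqrt P.[w]).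
  apply: bounded_C1M; first exact: bounded_C1_cst.
  apply: (bounded_C1_sqrt nP (c := 1 / 2)) => [|w /andP[w0 _]]; [lra|exact: P12].
have nm : bounded_C1 m.
  apply: bounded_C1M; first exact: bounded_C1_horner.
  apply: bounded_C1M.
    by apply: (bounded_C1V nQ (c := 1)) => // w /andP[w0 _]; exact: Q1.
  apply: bounded_C1M.
    apply: (bounded_C1V (c := 1)) => [||w /andP[w0 _]] //; first exact: bounded_C1D.
    by apply: ler_wpDl (Q1 w w0); rewrite !mulr_ge0 ?sqrtr_ge0 ?(ltW sg0).
  apply: (bounded_C1V nsP (c := sg)) => // w /andP[w0 _].
  have := sqP w w0; nra.
have [m' [Cm Hm]] := nm.
have Cm0 : 0 <= Cm by have [|_ h _] := Hm 0; [lra|exact: le_trans h].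
(* The factor 2 counts both sides of the stationary point. The tails at b and a give 12 = 4 + 8; 7
   is the length bound 5 plus two boundary terms. *)
exists (2 * kc / sg), (2 * ks / sg), (12 / sg + 7 * Cm); split.
- by rewrite divr_gt0 ?mulr_gt0.
- by rewrite ltr_pwDl ?divr_gt0 ?mulr_ge0.
move=> la a b th F la0 /andP[a0 a1] /andP[b1 b2] dF.
have [Phi [dPhi oddPhi limPhi]] := fres th.
pose q := Num.sqrt la; have q0 : 0 < q by rewrite sqrtr_gt0.
have q2 : q ^+ 2 = la by rewrite sqr_sqrtr // ltW.
pose ph w := th - 2 * pi * (la * (phase_poly d).[w]).
pose Theta w := F w - (sg * q)^-1 * Phi (q * S w) + (2 * pi * la)^-1 * (sin (ph w) * m w).
have pi2 := pi_ge2 R.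
have dTheta w : 0 <= w <= 5 -> is_derive w 1 Theta ((2 * pi * la)^-1 * (sin (ph w) * m' w)).
  move=> ww; have /andP[w0 w5] := ww; have h1 := dF w ww.
  have [h2 _ _] := Hm w ww.
  have P0 : 0 < P.[w] by apply: lt_le_trans (P12 w w0); lra.
  have s0 : 0 < Num.sqrt P.[w] by rewrite sqrtr_gt0.
  have Q0 : 0 < Q.[w] by apply: lt_le_trans (Q1 w w0).
  have hP : is_derive w 1 (fun y => P.[y]) P^`().[w] by exact: is_derive_poly.
  have hs : is_derive w 1 (fun y => Num.sqrt P.[y]) ((2 * Num.sqrt P.[w])^-1 * P^`().[w]).
    exact: (@is_derive1_comp _ Num.sqrt (horner P) w _ _ (is_derive1_sqrt P0) hP).
  have hS : is_derive w 1 S (Q.[w] / (2 * Num.sqrt P.[w])).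
    rewrite /S; apply: is_derive_eq; rewrite /GRing.scale /= QE.
    set r := Num.sqrt _ in s0 *.
    have -> : P.[w] = r ^+ 2 by rewrite sqr_sqrtr // ltW.
    by field; rewrite gt_eqF.
  have hPhi : is_derive w 1 (fun y => Phi (q * S y))
      (cos (th - 2 * pi * (q * S w) ^+ 2) * (q * (Q.[w] / (2 * Num.sqrt P.[w])))).
    have hq : is_derive w 1 (fun y => q * S y) (q * (Q.[w] / (2 * Num.sqrt P.[w]))).
      by apply: is_derive_eq; rewrite /GRing.scale /=; ring.
    exact: (@is_derive1_comp _ Phi _ w _ _ (dPhi _) hq).
  have hp : is_derive w 1 (fun y => (phase_poly d).[y]) ((w - 1) * Q.[w]).
    have := is_derive_poly (phase_poly d) w.
    by rewrite p'Q hornerM X1.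
  have hph : is_derive w 1 ph (- (2 * pi * (la * ((w - 1) * Q.[w])))).
    by rewrite /ph; apply: is_derive_eq; rewrite /GRing.scale /=; ring.
  have hsin : is_derive w 1 (fun y => sin (ph y))
      (cos (ph w) * - (2 * pi * (la * ((w - 1) * Q.[w])))).
    exact: (@is_derive1_comp _ sin ph w _ _ (is_derive_sin _) hph).
  have phE : th - 2 * pi * (q * S w) ^+ 2 = ph w.
    by rewrite /ph pE exprMn q2 /S exprMn sqr_sqrtr ?(ltW P0) //.
  rewrite phE in hPhi.
  rewrite /Theta; apply: is_derive_eq; rewrite /GRing.scale /=.
  have mE : m w * ((w - 1) * Q.[w]) = 1 - Q.[w] / (2 * sg * Num.sqrt P.[w]).
    have := congr1 (fun p : {poly R} => p.[w]) TE.
    rewrite hornerD hornerN hornerZ horner_exp hornerM hornerXsubC -sg2 /m; set r := Num.sqrt _ in s0 *.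
    have -> : P.[w] = r ^+ 2 by rewrite sqr_sqrtr // ltW.
    move: (Q.[w]) (T.[w]) Q0 => y t Q0 tE.
    have d0' : 2 * sg * r + y != 0 by rewrite gt_eqF // addr_gt0 ?mulr_gt0.
    have -> : t * (y^-1 * ((2 * sg * r + y)^-1 / (2 * sg * r))) * ((w - 1) * y) =
      t * (w - 1) / ((2 * sg * r + y) * (2 * sg * r)).
      by field; rewrite d0' !gt_eqF.
    by rewrite -tE; field; rewrite d0' !gt_eqF.
  rewrite -/(ph w); set c := cos (ph w); set r := Num.sqrt _ in s0 mE *.
  have -> : (sg * q)^-1 * (c * (q * (Q.[w] / (2 * r)))) = c * (Q.[w] / (2 * sg * r)).
    by field; rewrite !gt_eqF.
  have -> : m w * (c * - (2 * pi * (la * ((w - 1) * Q.[w])))) =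
    - (2 * pi * la) * (c * (m w * ((w - 1) * Q.[w]))) by ring.
  rewrite mE; move: (@pi R) (pi_gt0 R) => p p0.
  by field; rewrite !gt_eqF.
have ab : a <= b by lra.
pose u : R := (2 * pi * la)^-1.
have u0 : 0 <= u by rewrite invr_ge0 !mulr_ge0 ?pi_ge0 // ltW.
have ula : u <= la^-1 by rewrite lef_pV2 ?posrE ?mulr_gt0 ?pi_gt0 //; nra.
have HT : `|Theta b - Theta a| <= u * Cm * (b - a).
  apply: (@derive_norm_le_cst _ Theta _ a b _ ab (fun w ww => dTheta w _)) => w /andP[w0 w5].
    by lra.
  have [_ _ h] : [/\ is_derive w 1 m (m' w), `|m w| <= Cm & `|m' w| <= Cm].
    by apply: Hm; lra.
  rewrite normrM (ger0_norm u0) ler_wpM2l // normrM -[leRHS]mul1r ler_pM //.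
  exact: sin_max.
have HT5 : u * Cm * (b - a) <= 5 * (u * Cm).
  by rewrite mulrC ler_wpM2r ?mulr_ge0 //; lra.
have Hsm w : 0 <= w <= 5 -> `|u * (sin (ph w) * m w)| <= u * Cm.
  move=> ww; have [_ h _] := Hm w ww.
  rewrite normrM (ger0_norm u0) ler_wpM2l // normrM -[leRHS]mul1r ler_pM //.
  exact: sin_max.
have Ha := Hsm a; have Hb := Hsm b.
pose k := cos th * kc + sin th * ks.
have qi0 : 0 <= q^-1 by rewrite invr_ge0 ltW.
have Sb : 1 / 2 <= S b.
  by have := sqP b; rewrite /S; set r := Num.sqrt _; nra.
have Sa : 1 / 4 <= - S a.
  by have := sqP a a0; rewrite /S; set r := Num.sqrt _; nra.
have Pb : `|Phi (q * S b) - k| <= 4 / q.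
  apply: le_trans (limPhi _ _) _; first by rewrite mulr_gt0 //; lra.
  rewrite invfM mulrCA [leRHS]mulrC ler_wpM2l // -[leLHS]/(2 / S b) ler_pdivrMr; lra.
have Pa : `|Phi (q * - S a) - k| <= 8 / q.
  apply: le_trans (limPhi _ _) _; first by rewrite mulr_gt0 //; lra.
  rewrite invfM mulrCA [leRHS]mulrC ler_wpM2l // -[leLHS]/(2 / - S a) ler_pdivrMr; lra.
have PSa : Phi (q * S a) = - Phi (q * - S a) by rewrite mulrN oddPhi opprK.
have -> : F b - F a - (cos th * (2 * kc / sg) + sin th * (2 * ks / sg)) / Num.sqrt la =
  (Theta b - Theta a) - u * (sin (ph b) * m b) + u * (sin (ph a) * m a) +
  (sg * q)^-1 * ((Phi (q * S b) - k) + (Phi (q * - S a) - k)).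
  rewrite /Theta PSa -/u /k -/q; field; rewrite !gt_eqF //.
have sq0 : 0 <= (sg * q)^-1 by rewrite invr_ge0 mulr_ge0 // ltW.
have HP : `|(sg * q)^-1 * ((Phi (q * S b) - k) + (Phi (q * - S a) - k))| <= 12 / sg / la.
  rewrite normrM (ger0_norm sq0).
  apply: (@le_trans _ _ ((sg * q)^-1 * (12 / q))).
    rewrite ler_wpM2l //; apply: le_trans (ler_normD _ _) _.
    by apply: le_trans (lerD Pb Pa) _; rewrite -mulrDl ler_wpM2r //; lra.
  by rewrite -q2 le_eqVlt; apply/orP; left; apply/eqP; field; rewrite !gt_eqF.
have uC : u * Cm <= la^-1 * Cm by rewrite ler_wpM2r.
have {}Ha := Ha _; have {}Hb := Hb _.
have hA : `|u * (sin (ph a) * m a)| <= u * Cm by apply: Ha; lra.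
have hB : `|u * (sin (ph b) * m b)| <= u * Cm by apply: Hb; lra.
apply: le_trans (ler_normD _ _) _; rewrite mulrDl [leRHS]addrC; apply: lerD => //.
apply: le_trans (ler_normD _ _) _.
apply: (@le_trans _ _ (5 * (u * Cm) + u * Cm + u * Cm)).
  apply: lerD => //; apply: le_trans (ler_normB _ _) _; apply: lerD => //.
  exact: le_trans HT HT5.
by rewrite -mulrA [Cm / la]mulrC; set v := u * Cm in uC *; set v' := _ * Cm in uC *; lra.
Qed.

End StationaryPhase.
(** * The dual sum *)

Section DualSum.
Variable R : realType.
Implicit Types (t x v w s : R) (z : R[i]).

Local Notation normc := ComplexField.Normc.normc.

Lemma ComplexB (a b a' b' : R) :
  Complex a b - Complex a' b' = Complex (a - a') (b - b').
Proof. by []. Qed.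

Lemma ComplexM (a b a' b' : R) :
  Complex a b * Complex a' b' = Complex (a * a' - b * b') (a * b' + b * a').
Proof. by []. Qed.

Lemma normc_le_add (a b : R) : normc (Complex a b) <= `|a| + `|b|.
Proof.
rewrite /= -[leRHS]ger0_norm ?addr_ge0 // -sqrtr_sqr ler_wsqrtr // sqrrD.
rewrite !real_normK ?num_real // -addrA lerD2l addrC lerDl.
by rewrite mulrn_wge0 // mulr_ge0.
Qed.

(** Rotating z reduces a complex estimate to a real one, to which the mean value inequality
    applies. *)
Lemma normc_le_Re z (B : R) :
  (forall u, normc u = 1 -> complex.Re (u * z) <= B) -> normc z <= B.
Proof.
move=> H; have [z0|z0] := eqVneq (normc z) 0.
  have := H 1 (ComplexField.Normc.normc1 _); rewrite mul1r.
  by rewrite z0 (ComplexField.Normc.eq0_normc z0).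
have zp : 0 < normc z by rewrite lt_neqAle eq_sym z0 normc_ge0.
case: z z0 zp H => a b z0 zp H; set r := normc _ in z0 zp *.
have r2 : r ^+ 2 = a ^+ 2 + b ^+ 2 by rewrite normc_sqr.
have := H (Complex (a / r) (- b / r)) _.
have -> : normc (Complex (a / r) (- b / r)) = 1.
  rewrite /= !exprMn sqrrN -mulrDl -r2 -exprMn divff // expr1n; exact: sqrtr1.
move=> /(_ erefl); rewrite /=.
have -> : a / r * a - - b / r * b = (a ^+ 2 + b ^+ 2) / r by ring.
by rewrite -r2 expr2 mulfK.
Qed.

Lemma is_derive_sum_seq (I : Type) (r : seq I) (h : I -> R -> R) (dh : I -> R) x :
  (forall i, is_derive x 1 (h i) (dh i)) ->
  is_derive x 1 (fun y => \sum_(i <- r) h i y) (\sum_(i <- r) dh i).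
Proof.
move=> H; elim: r => [|i r IHr].
  rewrite big_nil (_ : (fun y => _) = cst 0); first exact: is_derive_cst.
  by apply/funext => y; rewrite big_nil.
rewrite big_cons (_ : (fun y => _) = (h i + (fun y => \sum_(j <- r) h j y))).
  by have h1 := H i; exact: is_deriveD.
by apply/funext => y; rewrite big_cons.
Qed.

Section DualIntegral.
Variables (d : nat) (t : R).
Hypotheses (d0 : (0 < d)%N) (t0 : 0 < t).

Local Notation al := (d.+1%:R / d%:R : R).
Local Notation c := (c_coef t d.+1%:Z).

(** The derivative t alpha n^(alpha-1) of the original phase, which is the critical point of
    [dual_phase n]. *)
Definition stat_point (n : nat) : R := t * al * n%:R `^ d%:R^-1.

Definition dual_phase (n : nat) v : R := v * n%:R - c * v ^+ d.+1.

Let dR : 0 < d%:R :> R. Proof. by rewrite ltr0n. Qed.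

Lemma stat_point_gt0 n : (0 < n)%N -> 0 < stat_point n.
Proof. by move=> n0; rewrite !mulr_gt0 ?invr_gt0 ?powR_gt0 ?ltr0n. Qed.

Lemma stat_pointX n : stat_point n ^+ d = (t * al) ^+ d * n%:R.
Proof.
by rewrite exprMn -[(n%:R `^ _) ^+ d]powR_mulrn ?powR_ge0 // -powRrM mulVf ?gt_eqF // powRr1.
Qed.

Lemma c_stat_pointX n : c * stat_point n ^+ d = n%:R / d.+1%:R.
Proof.
rewrite stat_pointX c_coefE /c_const !exprMn exprVn [d.+1%:R ^+ d.+1]exprS.
have nd : d.+1%:R != 0 :> R by rewrite pnatr_eq0.
have nd2 : d.+1%:R ^+ d != 0 :> R by rewrite expf_neq0.
have nd3 : d%:R ^+ d != 0 :> R by rewrite expf_neq0 // gt_eqF.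
have nt : t ^+ d != 0 by rewrite expf_neq0 // gt_eqF.
move: (d.+1%:R ^+ d : R) (d%:R ^+ d : R) (t ^+ d) (d.+1%:R : R) nd nd2 nd3 nt.
by move=> a b T D n1 n2 n3 n4; field; rewrite ?n1 ?n2 ?n3 ?n4.
Qed.

Lemma mul_stat_point n : n%:R * stat_point n = t * al * n%:R `^ al.
Proof.
case: n => [|n]; first by rewrite mul0r powR0 ?mulr0 // gt_eqF // divr_gt0 ?ltr0n.
rewrite /stat_point mulrCA; congr (_ * _).
rewrite (_ : al = 1 + d%:R^-1); last by rewrite -natr1 mulrDl divff ?gt_eqF // mul1r.
by rewrite powRD_gt0 ?ltr0n // powRr1.
Qed.

Lemma dual_phaseE n w :
  dual_phase n (stat_point n * w) =
  t * n%:R `^ al - n%:R * stat_point n * (phase_poly R d).[w].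
Proof.
rewrite /dual_phase exprMn [stat_point n ^+ d.+1]exprSr mulrA mulrA c_stat_pointX.
have -> : t * n%:R `^ al = n%:R * stat_point n * (1 - d.+1%:R^-1).
  have nd : d%:R != 0 :> R by rewrite gt_eqF.
  have nd1 : d.+1%:R != 0 :> R by rewrite pnatr_eq0.
  have dE : d.+1%:R = d%:R + 1 :> R by rewrite natr1.
  rewrite mul_stat_point; move: (n%:R `^ al) => P; rewrite dE in nd1 *.
  by move: (d%:R : R) nd nd1 => D h1 h2; field; rewrite ?h1 ?h2.
rewrite /phase_poly hornerD hornerC hornerD hornerN hornerX hornerZ hornerXn; ring.
Qed.

(** Rescaling by v_n gives la = n v_n, and the error v_n C / la is C/n. The sine integral is the
    cosine one with th shifted by - pi/2, so the complex constant is k1 - i k2, nonzero because k2 >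
    0. *)
Lemma dual_integral : exists k : R[i], exists C : R, [/\ k != 0, 0 < C &
  forall (n : nat) (A B : R) (Gc Gs : R -> R), (0 < n)%N ->
  0 <= A -> A <= stat_point n / 2 ->
  2 * stat_point n <= B -> B <= 5 * stat_point n ->
  (forall v, is_derive v 1 Gc (cos (2 * pi * dual_phase n v))) ->
  (forall v, is_derive v 1 Gs (sin (2 * pi * dual_phase n v))) ->
  normc (Complex (Gc B - Gc A) (Gs B - Gs A) -
         (stat_point n / Num.sqrt (n%:R * stat_point n))%:C%C * (e (t * n%:R `^ al) * k))
  <= C / n%:R].
Proof.
have [k1 [k2 [C [k20 C0 H]]]] := stationary_phase R d0.
exists (Complex k1 (- k2)), (2 * C); split.
- by rewrite eq_complex /= negb_and oppr_eq0 (gt_eqF k20) orbT.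
- by rewrite mulr_gt0.
move=> n A B Gc Gs n0 A0 A1 B1 B2 dGc dGs.
have v0 := stat_point_gt0 n0; set v := stat_point n in A1 B1 B2 v0 *.
have nR : 0 < n%:R :> R by rewrite ltr0n.
pose la := n%:R * v; have la0 : 0 < la by rewrite mulr_gt0.
pose a := A / v; pose b := B / v.
have a01 : 0 <= a <= 1 / 2.
  rewrite divr_ge0 ?(ltW v0) //= ler_pdivrMr //; lra.
have b25 : 2 <= b <= 5 by rewrite ler_pdivlMr // ler_pdivrMr // B1.
have vE (y : R) : v * (y / v) = y by rewrite mulrC divfK // gt_eqF.
pose th := 2 * pi * (t * n%:R `^ al).
have key (G g : R -> R) (ph : R) :
  (forall y : R, is_derive y 1 G (g y)) ->
  (forall w, g (v * w) = cos (ph - 2 * pi * (la * (phase_poly R d).[w]))) ->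
  `|(G B - G A) - v / Num.sqrt la * (cos ph * k1 + sin ph * k2)| <= C / n%:R.
  move=> dG gE.
  have dF w : 0 <= w <= 5 -> is_derive w 1 (fun w => v^-1 * G (v * w))
     (cos (ph - 2 * pi * (la * (phase_poly R d).[w]))).
    move=> _; have hv : is_derive w 1 (fun y => v * y) v.
      by apply: is_derive_eq; rewrite /GRing.scale /=; ring.
    have hG : is_derive w 1 (fun y => G (v * y)) (g (v * w) * v).
      exact: (@is_derive1_comp _ G _ w _ _ (dG _) hv).
    apply: is_derive_eq; rewrite /GRing.scale /= gE ?mulr0 ?addr0.
    by rewrite mulrC mulfK // gt_eqF.
  have := H la a b ph _ la0 a01 b25 dF; rewrite /a /b !vE -mulrBr.
  have -> : G B - G A - v / Num.sqrt la * (cos ph * k1 + sin ph * k2) =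
     v * (v^-1 * (G B - G A) - (cos ph * k1 + sin ph * k2) / Num.sqrt la).
    by rewrite mulrBr mulVKf ?gt_eqF // mulrA [v * _]mulrC; ring.
  rewrite normrM (ger0_norm (ltW v0)) => h.
  have -> : C / n%:R = v * (C / la).
    by rewrite /la; field; rewrite !gt_eqF.
  by rewrite ler_wpM2l // ltW.
have hc := key Gc _ th dGc _; have hs := key Gs _ (th - pi / 2) dGs _.
have E := dual_phaseE n; rewrite -/v in E.
have {}hc : `|Gc B - Gc A - v / Num.sqrt la * (cos th * k1 + sin th * k2)| <= C / n%:R.
  by apply: hc => w; rewrite E -/la /th; congr cos; ring.
have {}hs : `|Gs B - Gs A - v / Num.sqrt la * (sin th * k1 - cos th * k2)| <= C / n%:R.
  rewrite cosBpihalf sinBpihalf mulNr in hs; apply: hs => w.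
  by rewrite E -/la addrAC cosBpihalf /th; congr sin; ring.
rewrite (_ : _ - _ = Complex (Gc B - Gc A - v / Num.sqrt la * (cos th * k1 + sin th * k2))
   (Gs B - Gs A - v / Num.sqrt la * (sin th * k1 - cos th * k2))); last first.
  by rewrite /e -/th !ComplexM ComplexB; congr Complex; ring.
apply: le_trans (normc_le_add _ _) _.
apply: le_trans (lerD hc hs) _.
by rewrite le_eqVlt; apply/orP; left; apply/eqP; ring.
Qed.

End DualIntegral.
End DualSum.

(** * Dirichlet kernel, folding, and removal of the amplitude *)

Section DualSumBound.
Variable R : realType.
Implicit Types (t x v w s : R) (z : R[i]).

Local Notation normc := ComplexField.Normc.normc.

(** Combines the bounds N and 1/s + 1/(1-s); adding 1/N to the denominators covers both at the cost
    of a factor 2 and leaves an explicit logarithmic antiderivative. *)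
Lemma dirichlet_kernel_le (N N' : nat) s : (0 < N)%N -> (N' <= 2 * N)%N ->
  0 <= s <= 1 ->
  normc (\sum_(N <= n < N') e (s * n%:R)) <=
  2 * (s + N%:R^-1)^-1 + 2 * (1 - s + N%:R^-1)^-1.
Proof.
move=> N0 N2 /andP[s0 s1].
have NR : 0 < N%:R :> R by rewrite ltr0n.
set i := N%:R^-1; have i0 : 0 < i by rewrite invr_gt0.
have Ni : N%:R = i^-1 by rewrite /i invrK.
set D := \sum_(_ <= _ < _) _.
have DE : D = \sum_(k < N' - N) e (s * N%:R + k%:R * s).
  rewrite /D -{1}[N]add0n big_addn big_mkord; apply: eq_bigr => k _.
  by rewrite natrD; congr e; ring.
have p1 : 0 <= 2 * (s + i)^-1 by rewrite mulr_ge0 // invr_ge0; lra.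
have p2 : 0 <= 2 * (1 - s + i)^-1 by rewrite mulr_ge0 // invr_ge0; lra.
have DN : normc D <= i^-1.
  rewrite DE; apply: le_trans (normc_e_sum_le _ (fun k => s * N%:R + k%:R * s)) _.
  by rewrite -Ni ler_nat leq_subLR addnn -mul2n.
have half (y : R) : 0 <= y -> y <= i -> i^-1 <= 2 * (y + i)^-1.
  move=> y0 yi; rewrite -[leLHS]mul1r ler_pdivrMr // mulrAC ler_pdivlMr; lra.
have [si|si] := leP s i; first by have := half s s0 si; lra.
have [si'|si'] := leP (1 - s) i.
  by have := half (1 - s) _ si'; rewrite subr_ge0 => /(_ s1); lra.
have dbl (y : R) : i < y -> y^-1 <= 2 * (y + i)^-1.
  move=> yi; rewrite -[leLHS]mul1r ler_pdivrMr; last lra.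
  by rewrite mulrAC ler_pdivlMr; lra.
have s01 : 0 < s < 1 by apply/andP; split; lra.
have sin0 : 0 < `|sin (pi * s)|.
  rewrite normr_gt0 gt_eqF //; apply: sin_gt0_pi.
  by rewrite mulr_gt0 ?pi_gt0 ?(lt_trans i0) //= -[ltRHS]mulr1 ltr_pM2l ?pi_gt0 //; lra.
have : normc D <= `|sin (pi * s)|^-1.
  rewrite -[leRHS]mul1r ler_pdivlMr // DE; exact: geometric_sum_le.
move=> h; apply: le_trans h _; apply: le_trans (sinpi_inv_le s01) _.
by apply: lerD; apply: dbl.
Qed.

Lemma dirichlet_kernel_antiderivative (N : nat) s : (0 < N)%N -> 0 <= s <= 1 ->
  is_derive s 1 (fun y => 2 * ln (y + N%:R^-1) - 2 * ln (1 - y + N%:R^-1))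
    (2 * (s + N%:R^-1)^-1 + 2 * (1 - s + N%:R^-1)^-1).
Proof.
move=> N0 /andP[s0 s1]; have i0 : 0 < N%:R^-1 :> R by rewrite invr_gt0 ltr0n.
set i := N%:R^-1 in i0 *.
have y0 : 0 < s + i by lra.
have y1 : 0 < 1 - s + i by lra.
have h1 : is_derive s 1 (fun y => ln (y + i)) ((s + i)^-1 * 1).
  have hs : is_derive s 1 (fun y => y + i) 1 by apply: is_derive_eq; rewrite addr0.
  exact: (@is_derive1_comp _ (@ln R) _ s _ _ (is_derive1_ln y0) hs).
have h2 : is_derive s 1 (fun y => ln (1 - y + i)) ((1 - s + i)^-1 * -1).
  have hs : is_derive s 1 (fun y => 1 - y + i) (- 1) by apply: is_derive_eq; ring.
  exact: (@is_derive1_comp _ (@ln R) _ s _ _ (is_derive1_ln y1) hs).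
by apply: is_derive_eq; rewrite /GRing.scale /=; ring.
Qed.

(* Unfolding [Gc], [Gs] as integrals of [e (dual_phase n v)] over [A, A + L], the
   sum over [n] is a Dirichlet kernel evaluated at [x + v]; since [x + A] is an
   integer, folding [A, A + L] onto [0, 1] leaves a Weyl sum of degree [d.+1]. *)
Lemma dual_sum_le (d : nat) (t x A W : R) (m : int) (L N N' : nat)
    (Gc Gs : nat -> R -> R) :
  (0 < N)%N -> (N' <= 2 * N)%N -> A + x = m%:~R -> 0 <= W ->
  (forall s, normc (expsum (fun j => - c_coef t d.+1%:Z * (A + s + j%:R) ^+ d.+1) L) <= W) ->
  (forall n v, is_derive v 1 (Gc n) (cos (2 * pi * dual_phase d t n v))) ->
  (forall n v, is_derive v 1 (Gs n) (sin (2 * pi * dual_phase d t n v))) ->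
  normc (\sum_(N <= n < N') e (x * n%:R) *
    Complex (Gc n (A + L%:R) - Gc n A) (Gs n (A + L%:R) - Gs n A)) <=
  4 * W * ln N.+1%:R.
Proof.
move=> N0 N2 Ax W0 HW dGc dGs; apply: normc_le_Re => u u1.
pose z n := u * e (x * n%:R).
pose P n j s := complex.Re (z n) * Gc n (A + j%:R + s) - complex.Im (z n) * Gs n (A + j%:R + s).
pose H s := \sum_(N <= n < N') \sum_(0 <= j < L) P n j s.
pose ph n j s := dual_phase d t n (A + j%:R + s).
pose dP n j s := complex.Re (z n) * cos (2 * pi * ph n j s) -
   complex.Im (z n) * sin (2 * pi * ph n j s).
have dPP n j s : is_derive s 1 (P n j) (dP n j s).
  have hs : is_derive s 1 (fun y => A + j%:R + y) 1 by apply: is_derive_eq; ring.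
  have h1 : is_derive s 1 (fun y => Gc n (A + j%:R + y)) (cos (2 * pi * ph n j s) * 1).
    exact: (@is_derive1_comp _ (Gc n) _ s _ _ (dGc n _) hs).
  have h2 : is_derive s 1 (fun y => Gs n (A + j%:R + y)) (sin (2 * pi * ph n j s) * 1).
    exact: (@is_derive1_comp _ (Gs n) _ s _ _ (dGs n _) hs).
  by rewrite /P; apply: is_derive_eq; rewrite /GRing.scale /= /dP; ring.
have dH s : is_derive s 1 H (\sum_(N <= n < N') \sum_(0 <= j < L) dP n j s).
  by apply: is_derive_sum_seq => n; apply: is_derive_sum_seq => j; exact: dPP.
have dPE s : \sum_(N <= n < N') \sum_(0 <= j < L) dP n j s =
    complex.Re (u * ((\sum_(N <= n < N') e (s * n%:R)) *
      expsum (fun j => - c_coef t d.+1%:Z * (A + s + j%:R) ^+ d.+1) L)).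
  rewrite mulr_suml mulr_sumr raddf_sum; apply: eq_bigr => n _.
  rewrite /expsum -(big_mkord xpredT (fun j => e (- c_coef t d.+1%:Z * (A + s + j%:R) ^+ d.+1))).
  rewrite !mulr_sumr raddf_sum; apply: eq_bigr => j _.
  have -> : dP n j s = complex.Re (z n * e (ph n j s)) by rewrite /dP; case: (z n).
  congr complex.Re; rewrite /z -mulrA -!eD; congr (_ * _).
  (* As x + A = m, the part (m + j) n of the phase is an integer and disappears, which separates n
     from j. *)
  have -> : x * n%:R + ph n j s =
      s * n%:R + - c_coef t d.+1%:Z * (A + s + j%:R) ^+ d.+1 + (m * n%:Z + j%:Z * n%:Z)%:~R.
    rewrite rmorphD !rmorphM /= -Ax -![(Posz _)%:~R]/(_%:R) /ph /dual_phase.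
    by rewrite [A + j%:R + s]addrAC; ring.
  by rewrite [LHS]eD e_int mulr1.
have H10 : H 1 - H 0 = complex.Re (u * \sum_(N <= n < N') e (x * n%:R) *
    Complex (Gc n (A + L%:R) - Gc n A) (Gs n (A + L%:R) - Gs n A)).
  transitivity (\sum_(N <= n < N') \sum_(0 <= j < L) (P n j 1 - P n j 0)).
    by rewrite /H -sumrB; apply: eq_bigr => n _; rewrite -sumrB.
  rewrite mulr_sumr raddf_sum; apply: eq_bigr => n _.
  rewrite mulrA -/(z n) /=.
  have -> : complex.Re (z n * Complex (Gc n (A + L%:R) - Gc n A) (Gs n (A + L%:R) - Gs n A)) =
     P n L 0 - P n 0%N 0.
    by rewrite /P !addr0; case: (z n) => p q /=; ring.
  (* The unit pieces join up, since P n j 1 = P n (j+1) 0. *)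
  rewrite -(telescope_sumr (fun j => P n j 0)) //; apply: eq_bigr => j _.
  by rewrite /P -[j.+1%:R]natr1 !addr0 addrA.
rewrite -H10.
pose g s := W * (2 * ln (s + N%:R^-1) - 2 * ln (1 - s + N%:R^-1)).
have dg s : 0 <= s <= 1 -> is_derive s 1 g
    (W * (2 * (s + N%:R^-1)^-1 + 2 * (1 - s + N%:R^-1)^-1)).
  move=> s01; have h := dirichlet_kernel_antiderivative N0 s01.
  by rewrite /g; apply: is_derive_eq; rewrite /GRing.scale /=; ring.
apply: le_trans (@derive_le _ H g _ _ 0 1 ler01 (fun s _ => dH s) dg _) _.
  move=> s s01; rewrite dPE; apply: le_trans (Re_le_normc _) _.
  rewrite !ComplexField.Normc.normcM u1 mul1r mulrC.
  apply: ler_pM; rewrite ?normc_ge0 //; exact: dirichlet_kernel_le.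
have NR : 0 < N%:R :> R by rewrite ltr0n.
have N1 : ln (1 + N%:R^-1) = ln N.+1%:R - ln N%:R :> R.
  rewrite (_ : 1 + _ = N.+1%:R / N%:R); last by rewrite -natr1 mulrDl mul1r divff // gt_eqF.
  by rewrite ln_div ?posrE.
rewrite /g subr0 subrr !add0r N1 lnV ?posrE // -mulrBr -!mulrA mulrCA mulrCA.
by rewrite le_eqVlt; apply/orP; left; apply/eqP; ring.
Qed.

(** Summation by parts; for monotone weights the total variation telescopes to at most w N'. *)
Lemma abel_sum_le (w : nat -> R) (y : nat -> R[i]) (N N' : nat) (B : R) :
  (N <= N')%N -> (forall n, 0 <= w n) -> (forall n, w n <= w n.+1) ->
  (forall M, (N <= M <= N')%N -> normc (\sum_(N <= n < M) y n) <= B) ->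
  normc (\sum_(N <= n < N') (w n)%:C%C * y n) <= 2 * w N' * B.
Proof.
move=> NN w0 wS HB; pose S M := \sum_(N <= n < M) y n.
have E M : (N <= M)%N -> \sum_(N <= n < M) (w n)%:C%C * y n =
    (w M)%:C%C * S M - \sum_(N <= n < M) (w n.+1 - w n)%:C%C * S n.+1.
  elim: M => [|M IHM NM].
    by rewrite leqn0 => /eqP ->; rewrite /S !big_geq // mulr0 subr0.
  have [NM'|] := leqP N M; last first.
    move=> MN; have -> : N = M.+1 by apply/eqP; rewrite eqn_leq NM.
    by rewrite /S !big_geq // mulr0 subr0.
  have SM : S M.+1 = S M + y M by rewrite /S big_nat_recr.
  rewrite big_nat_recr //= [in RHS]big_nat_recr //= IHM // SM rmorphB /=; ring.
have B0 : 0 <= B by apply: le_trans (HB N _); rewrite ?normc_ge0 // leqnn.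
rewrite E //; apply: le_trans (normcD _ _) _; rewrite normcN.
have h1 : normc ((w N')%:C%C * S N') <= w N' * B.
  rewrite ComplexField.Normc.normcM normc_real ger0_norm // ler_wpM2l //.
  by apply: HB; rewrite NN leqnn.
have h2 : normc (\sum_(N <= n < N') (w n.+1 - w n)%:C%C * S n.+1) <= w N' * B.
  apply: le_trans (normc_sum _ _ _) _.
  apply: (@le_trans _ _ (\sum_(N <= n < N') (w n.+1 - w n) * B)).
    rewrite big_nat [leRHS]big_nat; apply: ler_sum => n /andP[Nn nN].
    rewrite ComplexField.Normc.normcM normc_real ger0_norm ?subr_ge0 // ler_wpM2l ?subr_ge0 //.
    by apply: HB; rewrite nN leqW.
  by rewrite -mulr_suml telescope_sumr // ler_wpM2r // gerBl.
by apply: le_trans (lerD h1 h2) _; rewrite -mulrA mulr_natl mulr2n.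
Qed.

End DualSumBound.
(** * The bound for the Weyl sums *)

Section WeylBound.
Variable R : realType.
Implicit Types (t x : R).

Local Notation normc := ComplexField.Normc.normc.

Lemma exprz_1Bsucc (d : nat) : (2 : R) ^ (1 - d.+1%:Z) = (2 ^ d)%:R^-1.
Proof.
have -> : 1 - d.+1%:Z = - d%:Z by lia.
by rewrite -exprnN natrX.
Qed.

Section PositiveT.
Variables (d : nat) (t : R).
Hypotheses (d0 : (0 < d)%N) (t0 : 0 < t).

Local Notation al := (d.+1%:R / d%:R : R).
Local Notation v := (stat_point d t).

Let dR : 0 < d%:R :> R. Proof. by rewrite ltr0n. Qed.

Let alE : al = 1 + d%:R^-1.
Proof. by rewrite -natr1 mulrDl divff ?gt_eqF // mul1r. Qed.

Let ta0 : 0 < t * al.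
Proof. by rewrite mulr_gt0 ?divr_gt0. Qed.

Let di01 : 0 < (d%:R : R)^-1 <= 1.
Proof. by rewrite invr_gt0 dR invf_le1 // ler1n. Qed.

Lemma stat_point_homo : {homo v : m n / (m <= n)%N >-> m <= n}.
Proof.
move=> m n mn; rewrite ler_wpM2l ?(ltW ta0) //.
by apply: ge0_ler_powR; rewrite ?nnegrE ?invr_ge0 // ler_nat.
Qed.

Lemma stat_point_double n : v (2 * n)%N <= 2 * v n.
Proof.
rewrite /stat_point natrM powRM // [leRHS]mulrCA ler_wpM2l ?(ltW ta0) // ler_wpM2r ?powR_ge0 //.
by rewrite -[leRHS]powRr1 // ler_powR ?ler1n //; case/andP: di01.
Qed.

(** The reciprocal of the amplitude v_n / sqrt (n v_n); it grows like n^(1-alpha/2), monotonically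
    since alpha <= 2. *)
Definition inv_amplitude (n : nat) : R := Num.sqrt (n%:R / v n).

Lemma inv_amplitudeE n : (0 < n)%N ->
  inv_amplitude n = Num.sqrt (t * al)^-1 * n%:R `^ (1 - al / 2).
Proof.
move=> n0; have nR : 0 < n%:R :> R by rewrite ltr0n.
have -> : n%:R `^ (1 - al / 2) = Num.sqrt (n%:R `^ (1 - d%:R^-1)) :> R.
  rewrite -powR12_sqrt ?powR_ge0 // -powRrM alE; congr powR; lra.
rewrite -sqrtrM ?invr_ge0 ?(ltW ta0) // /inv_amplitude /stat_point; congr Num.sqrt.
by rewrite powRD_gt0 // powRr1 ?(ltW nR) // powRN invfM mulrCA.
Qed.

Lemma inv_amplitude_homo : {homo inv_amplitude : m n / (m <= n)%N >-> m <= n}.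
Proof.
move=> [|m] [|n] // mn; first by rewrite /inv_amplitude mul0r sqrtr0 sqrtr_ge0.
rewrite !inv_amplitudeE // ler_wpM2l ?sqrtr_ge0 //.
apply: ge0_ler_powR; rewrite ?nnegrE ?ler_nat // alE.
by case/andP: di01; lra.
Qed.

Lemma inv_amplitude_double n : (0 < n)%N ->
  inv_amplitude (2 * n) <= 2 * Num.sqrt (t * al)^-1 * n%:R `^ (1 - al / 2).
Proof.
move=> n0; rewrite inv_amplitudeE ?muln_gt0 // natrM powRM // mulrCA mulrA.
rewrite ler_wpM2r ?powR_ge0 // ler_wpM2r ?sqrtr_ge0 //.
have e1 : 1 - al / 2 <= 1 by rewrite gerBl divr_ge0 ?divr_ge0.
by rewrite -[leRHS]powRr1 // ler_powR // ler1n.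
Qed.

Lemma inv_amplitudeK n : (0 < n)%N ->
  v n / Num.sqrt (n%:R * v n) * inv_amplitude n = 1.
Proof.
move=> n0; have v0 := stat_point_gt0 d0 t0 n0; have nR : 0 < n%:R :> R by rewrite ltr0n.
have s0 : 0 < Num.sqrt (n%:R * v n) by rewrite sqrtr_gt0 mulr_gt0.
rewrite mulrAC; apply: (mulIf (lt0r_neq0 s0)); rewrite mulfVK ?gt_eqF // mul1r.
rewrite -[v n in LHS]ger0_norm ?ltW // -sqrtr_sqr /inv_amplitude -sqrtrM ?sqr_ge0 //.
by congr Num.sqrt; field; rewrite gt_eqF.
Qed.

Lemma dual_phase_antiderivative : exists Gc Gs : nat -> R -> R,
  (forall n (y : R), is_derive y 1 (Gc n) (cos (2 * pi * dual_phase d t n y))) /\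
  (forall n (y : R), is_derive y 1 (Gs n) (sin (2 * pi * dual_phase d t n y))).
Proof.
have dph n (y : R) : is_derive y 1 (fun y => 2 * pi * dual_phase d t n y)
    (2 * pi * (n%:R - c_coef t d.+1%:Z * (d.+1%:R * y ^+ d))).
  pose p : {poly R} := (2 * pi) *: (n%:R *: 'X - c_coef t d.+1%:Z *: 'X^(d.+1)).
  have pE z : p.[z] = 2 * pi * dual_phase d t n z.
    by rewrite /p /dual_phase hornerZ hornerD hornerN !hornerZ hornerX hornerXn [z * _]mulrC.
  have -> : 2 * pi * (n%:R - c_coef t d.+1%:Z * (d.+1%:R * y ^+ d)) = p^`().[y].
    rewrite /p derivZ derivB !derivZ derivX derivXn hornerZ hornerD hornerN !hornerZ.
    by rewrite hornerC mulr1 hornerMn hornerXn [_ * _ ^+ _]mulr_natl.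
  by rewrite -(funext pE); exact: is_derive_poly.
have cc n : exists G : R -> R,
    forall y : R, is_derive y 1 G (cos (2 * pi * dual_phase d t n y)).
  apply: (@antiderivative _ (fun y => cos (2 * pi * dual_phase d t n y))) => y.
  exact: (derive_continuous (@is_derive1_comp _ (@cos R) _ y _ _ (is_derive_cos _) (dph n y))).
have cs n : exists G : R -> R,
    forall y : R, is_derive y 1 G (sin (2 * pi * dual_phase d t n y)).
  apply: (@antiderivative _ (fun y => sin (2 * pi * dual_phase d t n y))) => y.
  exact: (derive_continuous (@is_derive1_comp _ (@sin R) _ y _ _ (is_derive_sin _) (dph n y))).
have [Gc HGc] := choice cc; have [Gs HGs] := choice cs.
by exists Gc, Gs.
Qed.

Lemma weyl_sum_dual_le : exists C1 C2 : R, [/\ 0 < C1, 0 < C2 &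
  forall (N L : nat) (W x : R), 2 <= v N -> (0 < N)%N ->
  2 * v (2 * N)%N <= L%:R <= 2 * v (2 * N)%N + 1 -> 0 <= W ->
  (forall y, normc (expsum (fun j => - c_coef t d.+1%:Z * (y + j%:R) ^+ d.+1) L) <= W) ->
  normc (weyl_sum t al x N) <=
  inv_amplitude (2 * N) * (C1 * (W * ln N.+1%:R) + C2)].
Proof.
have [k [C [k0 C0 dual]]] := dual_integral d0 t0.
have [Gc [Gs [dGc dGs]]] := dual_phase_antiderivative.
have K0 : 0 < normc k.
  rewrite lt_neqAle normc_ge0 andbT eq_sym; apply: contra k0 => /eqP h.
  exact/eqP/(ComplexField.Normc.eq0_normc h).
have Ki : 0 < (normc k)^-1 by rewrite invr_gt0.
exists (8 / normc k), (C / normc k); split; try by rewrite divr_gt0.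
move=> N L W x vN N0 /andP[L1 L2] W0 HW.
have NR : 0 < N%:R :> R by rewrite ltr0n.
(* The fractional part of -x: it makes A + x an integer and keeps A below all stationary points. *)
pose A := - x - (Num.floor (- x))%:~R.
have /andP[fl1 fl2] := floor_itv (- x).
have A0 : 0 <= A by rewrite /A; lra.
have A1 : A < 1 by rewrite /A; move: fl2; rewrite intrD; lra.
have Ax : A + x = (- Num.floor (- x))%:~R by rewrite /A mulrNz; ring.
pose DG n : R[i] := Complex (Gc n (A + L%:R) - Gc n A) (Gs n (A + L%:R) - Gs n A).
pose w := inv_amplitude.
have w0 n : 0 <= w n by exact: sqrtr_ge0.
pose er n := (w n)%:C%C * DG n - e (t * n%:R `^ al) * k.
have erP n : (N <= n < 2 * N)%N -> normc (er n) <= w (2 * N)%N * (C / N%:R).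
  move=> /andP[Nn n2]; have n0 : (0 < n)%N by exact: leq_trans Nn.
  have vNn := stat_point_homo Nn; have vn2 := stat_point_homo (ltnW n2).
  have v2 := stat_point_double N.
  (* The conditions hold for all n at once: A < 1 <= v_N / 2, L >= 2 v_(2N), and A + L <= 2 v_(2N) +
     2 <= 4 v_N + 2 <= 5 v_N. This is the origin of the constant 5. *)
  have h := dual n A (A + L%:R) (Gc n) (Gs n) n0 A0 _ _ _ (dGc n) (dGs n).
  have {}h : normc (DG n - (v n / Num.sqrt (n%:R * v n))%:C%C *
      (e (t * n%:R `^ al) * k)) <= C / n%:R by apply: h; lra.
  have -> : er n = (w n)%:C%C * (DG n - (v n / Num.sqrt (n%:R * v n))%:C%C *
      (e (t * n%:R `^ al) * k)).
    have E1 : (w n)%:C%C * (v n / Num.sqrt (n%:R * v n))%:C%C = 1.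
      transitivity ((w n * (v n / Num.sqrt (n%:R * v n)))%:C%C).
        exact: (esym (rmorphM (real_complex R) _ _)).
      by rewrite mulrC inv_amplitudeK.
    by rewrite mulrBr [_ * (_%:C%C * _)]mulrA E1 mul1r.
  rewrite ComplexField.Normc.normcM normc_real ger0_norm //.
  apply: ler_pM; rewrite ?normc_ge0 //; first exact/inv_amplitude_homo/ltnW.
  apply: le_trans h _; rewrite ler_wpM2l ?(ltW C0) // lef_pV2 ?posrE ?ltr0n //.
  by rewrite ler_nat.
have kS : k * weyl_sum t al x N =
    \sum_(N <= n < 2 * N) (w n)%:C%C * (e (x * n%:R) * DG n) -
    \sum_(N <= n < 2 * N) e (x * n%:R) * er n.
  rewrite -sumrB mulr_sumr; apply: eq_bigr => n _.
  by rewrite eD /er; ring.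
have NN : (N <= 2 * N)%N by rewrite leq_pmull.
have B1 : normc (\sum_(N <= n < 2 * N) (w n)%:C%C * (e (x * n%:R) * DG n)) <=
    2 * w (2 * N)%N * (4 * W * ln N.+1%:R).
  apply: abel_sum_le => // [n|M /andP[NM M2]]; first exact/inv_amplitude_homo.
  exact: (dual_sum_le N0 M2 Ax W0 (fun s => HW (A + s)) dGc dGs).
have B2 : normc (\sum_(N <= n < 2 * N) e (x * n%:R) * er n) <= w (2 * N)%N * C.
  apply: le_trans (normc_sum _ _ _) _.
  apply: (@le_trans _ _ (\sum_(N <= n < 2 * N) w (2 * N)%N * (C / N%:R))).
    rewrite big_nat [leRHS]big_nat; apply: ler_sum => n nN.
    by rewrite ComplexField.Normc.normcM normc_e mul1r; exact: erP.
  rewrite sumr_const_nat mul2n -addnn addnK -[leLHS]mulr_natl.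
  by rewrite le_eqVlt; apply/orP; left; apply/eqP; field; rewrite gt_eqF.
have : normc (k * weyl_sum t al x N) <=
    2 * w (2 * N)%N * (4 * W * ln N.+1%:R) + w (2 * N)%N * C.
  by rewrite kS; apply: le_trans (normcD _ _) _; rewrite normcN; exact: lerD.
rewrite ComplexField.Normc.normcM mulrC -ler_pdivlMr // => h.
apply: le_trans h _; rewrite le_eqVlt; apply/orP; left; apply/eqP.
by rewrite -/(w _); field; rewrite gt_eqF.
Qed.

Lemma ln_succ_le (e1 : R) : 0 < e1 -> exists2 K : R, 0 < K &
  forall N : nat, (0 < N)%N -> ln N.+1%:R <= K * N%:R `^ e1.
Proof.
move=> e0; exists (e1^-1 * 2 `^ e1) => [|N N0].
  by rewrite mulr_gt0 ?invr_gt0 // powR_gt0.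
have NR : 0 < N%:R :> R by rewrite ltr0n.
apply: (@le_trans _ _ (ln (2 * N%:R))).
  by rewrite ler_ln ?posrE ?mulr_gt0 // -natrM ler_nat; lia.
have : ln ((2 * N%:R) `^ e1) < (2 * N%:R) `^ e1.
  by apply: ln_sublinear; rewrite powR_gt0 // mulr_gt0.
rewrite ln_powR powRM // => h.
by rewrite -mulrA [leRHS]mulrC ler_pdivlMr // [leLHS]mulrC ltW.
Qed.

Lemma stat_point_ge2 : exists2 N0 : nat, (0 < N0)%N &
  forall N, (N0 <= N)%N -> 2 <= v N.
Proof.
exists (Num.truncn ((2 / (t * al)) ^+ d)).+1 => // N hN.
have q0 : 0 <= 2 / (t * al) by rewrite divr_ge0 // ltW.
rewrite /stat_point mulrC -ler_pdivrMr //.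
apply: powR_root => //; apply/ltW/(lt_le_trans (truncnS_gt _)).
by rewrite ler_nat.
Qed.

(** With e1 = eps/2 lost both in Weyl's inequality and in the logarithm, the total exponent (1 -
    alpha/2) + p/d + e1 is s + e1 (1 + 1/d) <= s + eps. *)
Lemma weyl_bound_of_well_approx : well_approx (c_coef t d.+1%:Z) ->
  weyl_bound al d.+1%:Z t.
Proof.
move=> cP eps eps0; have e10 : 0 < eps / 2 by rewrite divr_gt0.
have [CW CW0 HCW] := weyl_inequality d0 (well_approxN cP) e10.
have [K K0 HK] := ln_succ_le e10.
have [C1 [C2 [C10 C20 dual]]] := weyl_sum_dual_le.
have [N0 N00 HN0] := stat_point_ge2.
move: e10 HCW HK; set e1 := eps / 2 => e10 HCW HK.
pose m2 : R := (2 ^ d)%:R^-1.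
have m20 : 0 < m2 by rewrite invr_gt0 ltr0n expn_gt0.
have m21 : m2 <= 1 / 2.
  rewrite /m2 mul1r lef_pV2 ?posrE ?ltr0n ?expn_gt0 // (_ : 2 = (2 ^ 1)%:R) //.
  by rewrite ler_nat leq_pexp2l.
pose p := 1 - m2 + e1.
have p0 : 0 <= p by rewrite /p; lra.
pose s : R := al / 2 - (al - 1) * 2 ^ (1 - d.+1%:Z).
have sE : s = 1 / 2 + d%:R^-1 / 2 - d%:R^-1 * m2.
  by rewrite /s exprz_1Bsucc -/m2 alE; ring.
have /andP[di0 di1] := di01.
have s0 : 0 <= s + eps by rewrite sE; nra.
pose sq := Num.sqrt (t * al)^-1.
have sq0 : 0 <= sq by exact: sqrtr_ge0.
pose Ct : R := 2 * sq * (C1 * (CW * (5 * (t * al)) `^ p * K) + C2).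
have Ct0 : 0 <= Ct.
  by rewrite !mulr_ge0 ?addr_ge0 ?mulr_ge0 ?powR_ge0 ?(ltW C10) ?(ltW C20) ?(ltW CW0) ?(ltW K0).
(* Below [N0], where v_N may be under 2, the trivial bound N suffices because s + eps >= 0; the sum
   for N = 0 is empty. *)
exists (Ct + N0%:R) => N; apply: ub_ereal_sup => _ [x _ <-]; rewrite lee_fin.
have P0 : 0 <= N%:R `^ (s + eps) by exact: powR_ge0.
have [NN|NN] := ltnP N N0.
  apply: (@le_trans _ _ (N0%:R * N%:R `^ (s + eps))); last first.
    by rewrite ler_wpM2r // lerDr.
  have [->|Np] := posnP N.
    by rewrite /weyl_sum big_geq // ComplexField.Normc.normc0 mulr_ge0 // powR_ge0.
  apply: (@le_trans _ _ N%:R).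
    apply: le_trans (normc_sum _ _ _) _.
    under eq_bigr do rewrite normc_e.
    by rewrite sumr_const_nat mul2n -addnn addnK.
  rewrite -[leLHS]mulr1 ler_pM ?ler_nat ?(ltnW NN) //.
  by rewrite -[leLHS](powRr0 N%:R) ler_powR // ler1n.
have Np : (0 < N)%N by exact: leq_trans NN.
have NR : 0 < N%:R :> R by rewrite ltr0n.
have N1 : 1 <= N%:R :> R by rewrite ler1n.
apply: (@le_trans _ _ (Ct * N%:R `^ (s + eps))); last by rewrite ler_wpM2r // lerDl.
have vN := HN0 N NN; have v2 := stat_point_double N.
pose L := (Num.truncn (2 * v (2 * N)%N)).+1.
have vp : 0 <= 2 * v (2 * N)%N.
  by rewrite mulr_ge0 // ltW // stat_point_gt0 // muln_gt0.
have /andP[L1 L2] := truncn_itv vp; rewrite -/L in L2.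
have L3 : L%:R <= 2 * v (2 * N)%N + 1 by rewrite /L -natr1 lerD2r.
pose W := CW * L%:R `^ p.
have W0 : 0 <= W by rewrite mulr_ge0 ?powR_ge0 // ltW.
have h := dual N L W x vN Np (introT andP (conj (ltW L2) L3)) W0 (HCW L).
apply: le_trans h _.
have LW : W <= CW * (5 * (t * al)) `^ p * N%:R `^ (p / d%:R).
  rewrite /W -mulrA ler_wpM2l ?(ltW CW0) //.
  have -> : N%:R `^ (p / d%:R) = (N%:R `^ d%:R^-1) `^ p by rewrite -powRrM mulrC.
  rewrite -powRM ?powR_ge0 ?mulr_ge0 ?(ltW t0) ?divr_ge0 //.
  apply: ge0_ler_powR; rewrite ?nnegrE ?mulr_ge0 ?powR_ge0 ?(ltW t0) ?divr_ge0 //.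
  rewrite -mulrA -/(v N); lra.
have ln0 : 0 <= ln N.+1%:R :> R by rewrite ln_ge0 // ler1n.
have Npd : 1 <= N%:R `^ (p / d%:R + e1).
  rewrite -[leLHS](powRr0 N%:R) ler_powR // addr_ge0 ?(ltW e10) //.
  by rewrite divr_ge0.
have B : C1 * (W * ln N.+1%:R) + C2 <=
    (C1 * (CW * (5 * (t * al)) `^ p * K) + C2) * N%:R `^ (p / d%:R + e1).
  rewrite [leRHS]mulrDl; apply: lerD; last by rewrite ler_peMr // ltW.
  rewrite -mulrA ler_wpM2l ?(ltW C10) // [N%:R `^ (_ + _)]powRD_gt0 //.
  apply: le_trans (ler_pM W0 ln0 LW (HK N Np)) _.
  by rewrite le_eqVlt; apply/orP; left; apply/eqP; ring.
have C0 : 0 <= C1 * (W * ln N.+1%:R) + C2.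
  exact: addr_ge0 (mulr_ge0 (ltW C10) (mulr_ge0 W0 ln0)) (ltW C20).
apply: le_trans (ler_pM (sqrtr_ge0 _) C0 (inv_amplitude_double Np) B) _.
rewrite -/sq mulrACA -/Ct -powRD_gt0 // ler_wpM2l // ler_powR // sE /p alE.
have -> : eps = 2 * e1 by rewrite /e1; lra.
have : e1 * d%:R^-1 <= e1 by rewrite ler_piMr // ltW.
lra.
Qed.

End PositiveT.

Lemma sup_weyl_sumN (t al : R) (N : nat) : sup_weyl_sum t al N = sup_weyl_sum (- t) al N.
Proof.
suff H (u : R) : (sup_weyl_sum u al N <= sup_weyl_sum (- u) al N)%E.
  by apply/eqP; rewrite eq_le H -{2}[t]opprK H.
apply: ub_ereal_sup => _ [x _ <-]; apply: ereal_sup_ubound; exists (- x) => //.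
congr EFin; have -> : weyl_sum (- u) al (- x) N = (weyl_sum u al x N)^*%C.
  rewrite /weyl_sum rmorph_sum; apply: eq_bigr => n _ /=.
  rewrite (_ : - u * _ + _ = - (u * n%:R `^ al + x * n%:R)); last by ring.
  by rewrite eN.
by case: (weyl_sum u al x N) => a b /=; rewrite sqrrN.
Qed.

Lemma c_coefN (d : nat) (t : R) : c_coef (- t) d.+1%:Z = (-1) ^+ d * c_coef t d.+1%:Z.
Proof.
by rewrite !c_coefE [(- t) ^+ d]exprNn invfM -exprVn invrN1; ring.
Qed.

(** Conjugation exchanges (t, x) and (-t, -x), and the resulting sign of c is harmless by
    [well_approxN]. *)
Lemma weyl_bound_well_approx (d : nat) (t : R) : (0 < d)%N -> t != 0 ->
  well_approx (c_coef t d.+1%:Z) -> weyl_bound (d.+1%:R / d%:R) d.+1%:Z t.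
Proof.
move=> d0 tn0 cP; have [t0|t0] := ltP 0 t; first exact: weyl_bound_of_well_approx.
have tN : 0 < - t by rewrite oppr_gt0 lt_neqAle tn0.
have : weyl_bound (d.+1%:R / d%:R) d.+1%:Z (- t).
  apply: weyl_bound_of_well_approx => //; rewrite c_coefN.
  have [->|->] : (-1 : R) ^+ d = 1 \/ (-1 : R) ^+ d = -1.
    by rewrite -signr_odd; case: odd; [right|left].
  - by rewrite mul1r.
  - by rewrite mulN1r; exact: well_approxN.
move=> H eps /H[C HC]; exists C => N.
by rewrite sup_weyl_sumN; exact: HC.
Qed.

End WeylBound.
Unset Implicit Arguments.

Theorem theorem4p5 (R : realType) (alpha : R) (r : int)
    (halpha : 1 < alpha < 2) (hr : r%:~R = alpha / (alpha - 1)) :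
  (forall t : R, t != 0 -> khinchin_levy (c_coef t r) -> weyl_bound alpha r t) /\
  {ae (@lebesgue_measure R), forall t : R, weyl_bound alpha r t}.
Proof.
have /andP[a1 a2] := halpha.
have r2 : (2 : R) < r%:~R by rewrite hr ltr_pdivlMr; lra.
(* From alpha < 2 one gets r > 2, so d = r - 1 is a positive natural number. *)
have [d d0 rE] : exists2 d : nat, (0 < d)%N & r = d.+1%:Z.
  exists (absz r).-1; have : (2 < r)%R by rewrite -(ltr_int R).
    by lia.
  by lia.
subst r; have dR : 0 < d%:R :> R by rewrite ltr0n.
have aE : alpha = d.+1%:R / d%:R.
  move: hr; rewrite -[_%:~R]/(d.+1%:R) -natr1 => h.
  have h2 : (d%:R + 1) * (alpha - 1) = alpha by rewrite h divfK // gt_eqF; lra.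
  by apply: (mulIf (lt0r_neq0 dR)); rewrite divfK ?gt_eqF //; lra.
rewrite aE; split=> [t t0 /khinchin_levy_well_approx|].
  exact: weyl_bound_well_approx.
have h0 : (@lebesgue_measure R).-negligible [set (0 : R)].
  by apply/negligibleP => //; exact: lebesgue_measure_set1.
have := negligibleU (ae_well_approx R d0) h0.
apply: negligibleS => t /= tB; have [->|t0] := eqVneq t 0; first by right.
left => /(_ isT) H; apply: tB; exact: weyl_bound_well_approx.
Qed.
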